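(* Let $X$ be a nonzero Banach space, $\tau:\mathcal D\to\mathcal D$ injective, and $0<q\le p<2$. Then there is a constant $A(p,q)>0$ depending only on $p,q$ such that $$\|T_{\tau,q}\otimes\mathrm{Id}_X\|_q^{\frac{q}{2-q}}\le A(p,q)\,\|T_{\tau,p}\otimes\mathrm{Id}_X\|_p^{\frac{p}{2-p}}.$$
   Context: $\mathcal D$ is the collection of dyadic subintervals $[(k-1)2^{-n},k2^{-n})$ of $[0,1)$, $|I|$ Lebesgue measure; $h_I$ is the Haar function ($1$ on the left half of $I$, $-1$ on the right half, $0$ outside). For a finite $X$-valued Haar series $f=\sum_Ix_Ih_I$ let $\mathbb S(f)(t)=\big(\int_0^1\|\sum_Ir_I(s)x_Ih_I(t)\|_X^2ds\big)^{1/2}$ with $(r_I)$ independent Rademacher functions, and $\|f\|_{H^p_X}=\|\mathbb S(f)\|_{L^p[0,1]}$ ($0<p<\infty$). The rearrangement operator is $(T_{\tau,p}\otimes\mathrm{Id}_X)(\sum_Ix_Ih_I)=\sum_Ix_I(|I|/|\tau(I)|)^{1/p}h_{\tau(I)}$, and $\|T_{\tau,p}\otimes\mathrm{Id}_X\|_p$ is the supremum of $\|(T_{\tau,p}\otimes\mathrm{Id}_X)f\|_{H^p_X}$ over all $f$ with finite Haar support and $\|f\|_{H^p_X}\le1$ (possibly $+\infty$). *)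

(* Defs.v *)
From Stdlib Require Import Reals Lra Lia List.
Open Scope R_scope.

Record Banach := {
  bcar :> Type;
  bzero : bcar;
  badd : bcar -> bcar -> bcar;
  bopp : bcar -> bcar;
  bscal : R -> bcar -> bcar;
  bnorm : bcar -> R;
  badd_assoc : forall x y z, badd x (badd y z) = badd (badd x y) z;
  badd_comm : forall x y, badd x y = badd y x;
  badd_zero : forall x, badd x bzero = x;
  badd_opp : forall x, badd x (bopp x) = bzero;
  bscal_one : forall x, bscal 1 x = x;
  bscal_assoc : forall a b x, bscal a (bscal b x) = bscal (a * b) x;
  bscal_distr_l : forall a x y, bscal a (badd x y) = badd (bscal a x) (bscal a y);
  bscal_distr_r : forall a b x, bscal (a + b) x = badd (bscal a x) (bscal b x);
  bnorm_zero : forall x, bnorm x = 0 -> x = bzero;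
  bnorm_scal : forall a x, bnorm (bscal a x) = Rabs a * bnorm x;
  bnorm_triangle : forall x y, bnorm (badd x y) <= bnorm x + bnorm y;
  bcomplete : forall u : nat -> bcar,
    (forall eps, 0 < eps -> exists N, forall m n, (N <= m)%nat -> (N <= n)%nat ->
        bnorm (badd (u m) (bopp (u n))) < eps) ->
    exists l, forall eps, 0 < eps -> exists N, forall n, (N <= n)%nat ->
        bnorm (badd (u n) (bopp l)) < eps
}.

Definition nonzero_space (X : Banach) : Prop := exists x : X, x <> bzero X.

(** Power x^y for x >= 0, y > 0, with the convention 0^y = 0. *)
Definition rpow (x y : R) : R :=
  if Rle_dec x 0 then 0 else Rpower x y.

(** Dyadic intervals: (n,k) with k < 2^n stands for [k 2^-n, (k+1) 2^-n). *)
Definition Dyad : Type := { nk : nat * nat | (snd nk < 2 ^ fst nk)%nat }.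
Definition dlevel (I : Dyad) : nat := fst (proj1_sig I).
Definition dpos (I : Dyad) : nat := snd (proj1_sig I).

Definition dlen (I : Dyad) : R := / 2 ^ dlevel I.

Definition haar (I : Dyad) (t : R) : R :=
  let a := INR (dpos I) * dlen I in
  let m := (INR (dpos I) + / 2) * dlen I in
  let b := (INR (dpos I) + 1) * dlen I in
  if Rle_dec a t then
    if Rlt_dec t m then 1 else if Rlt_dec t b then -1 else 0
  else 0.

(** A finite X-valued Haar series  sum_I x_I h_I  is given by a list of
    pairs (I, x_I) with pairwise distinct intervals I. *)
Definition haar_series (X : Banach) := list (Dyad * X).
Definition valid_series {X : Banach} (f : haar_series X) : Prop :=
  NoDup (map fst f).

(** Sign pattern number j (j < 2^m) gives to the i-th term the sign
    (-1)^(bit i of j): these realize all values of (r_I(s))_I. *)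
Definition sgn (j i : nat) : R := if Nat.testbit j i then -1 else 1.

Fixpoint signed_sum {X : Banach} (f : haar_series X) (j i : nat) (t : R) : X :=
  match f with
  | nil => bzero X
  | Ix :: f' => badd X (bscal X (sgn j i * haar (fst Ix) t) (snd Ix)) (signed_sum f' j (S i) t)
  end.

Fixpoint rsum (n : nat) (g : nat -> R) : R :=
  match n with
  | O => 0
  | S n' => rsum n' g + g n'
  end.

(** Square function S(f)(t) = ( E_s || sum_I r_I(s) x_I h_I(t) ||^2 )^(1/2);
    the Rademacher expectation of a function of finitely many independent
    Rademacher variables is the average over all sign patterns. *)
Definition sqfun {X : Banach} (f : haar_series X) (t : R) : R :=
  let m := length f in
  sqrt (/ 2 ^ m * rsum (2 ^ m) (fun j => (bnorm X (signed_sum f j 0 t)) ^ 2)).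

Definition maxlev {X : Banach} (f : haar_series X) : nat :=
  fold_right (fun p acc => Nat.max (dlevel (fst p)) acc) 0%nat f.

(** ||f||_{H^p_X} = ||S(f)||_{L^p[0,1]}.  S(f) is constant on each dyadic
    interval of level N := maxlev f + 1, so the Lebesgue integral of S(f)^p
    over [0,1) is the finite sum below. *)
Definition Hnorm {X : Banach} (p : R) (f : haar_series X) : R :=
  let N := S (maxlev f) in
  rpow (rsum (2 ^ N) (fun j => / 2 ^ N * rpow (sqfun f (INR j / 2 ^ N)) p)) (/ p).

Definition Trearr {X : Banach} (tau : Dyad -> Dyad) (p : R) (f : haar_series X)
  : haar_series X :=
  map (fun Ix => (tau (fst Ix),
     bscal X (rpow (dlen (fst Ix) / dlen (tau (fst Ix))) (/ p)) (snd Ix))) f.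

Definition opnorm_le (X : Banach) (tau : Dyad -> Dyad) (p M : R) : Prop :=
  forall f : haar_series X, valid_series f -> Hnorm p f <= 1 ->
    Hnorm p (Trearr tau p f) <= M.

(* Main.v *)
(** Write [S_I] for the value on [I] of the square function of the part of [f]
    carried by the intervals containing [I], and put [m_I = delta + S_I].
    Abel summation over the levels shows that [g = sum m_I^(q/p-1) x_I h_I]
    satisfies [S(g) <= (p/q) (delta + S(f))^(q/p)] pointwise, hence [f = m^(1-q/p) g]
    is a factorization of [f] through [H^p] and a scalar maximal function.
    After rearrangement, the contraction principle and Hoelder's inequality bound
    [T_q f] by [T_p g] and by the integral of [sup_I m_I^q (|I| / |tau I|) 1_(tau I)].
    That integral is at most [C M^(2p/(2-p))] times the integral of [sup_I m_I^q 1_I]: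
    linearize the supremum by disjoint weights of relative size [c_I] on [tau I], test the
    bound [M] on the scalar series [sum m_I^(q/p) c_I^(1/2) h_I], and recover
    the linearized integral from the image by the factorization of [H^p] through [H^2].
    The powers of [M] add up to the exponent of the theorem. *)

Require Import Defs.
From Stdlib Require Import Reals Lra Lia List Psatz.
Open Scope R_scope.


(** * Finite sums *)

Lemma rsum_ext (n : nat) (g h : nat -> R) :
  (forall i, (i < n)%nat -> g i = h i) -> rsum n g = rsum n h.
Proof.
  induction n as [|n IH]; intros H; simpl; [reflexivity|].
  rewrite IH by (intros; apply H; lia). rewrite H by lia. reflexivity.
Qed.

Lemma rsum_le (n : nat) (g h : nat -> R) :
  (forall i, (i < n)%nat -> g i <= h i) -> rsum n g <= rsum n h.
Proof.
  induction n as [|n IH]; intros H; simpl; [lra|].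
  apply Rplus_le_compat; [apply IH; intros|]; apply H; lia.
Qed.

Lemma rsum_plus (n : nat) (g h : nat -> R) :
  rsum n (fun i => g i + h i) = rsum n g + rsum n h.
Proof. induction n as [|n IH]; simpl; [|rewrite IH]; lra. Qed.

Lemma rsum_scal (n : nat) (c : R) (g : nat -> R) :
  rsum n (fun i => c * g i) = c * rsum n g.
Proof. induction n as [|n IH]; simpl; [|rewrite IH]; lra. Qed.

Lemma rsum_const (n : nat) (c : R) : rsum n (fun _ => c) = INR n * c.
Proof. induction n as [|n IH]; [simpl; lra|]. rewrite S_INR; simpl; rewrite IH; lra. Qed.

Lemma rsum_nonneg (n : nat) (g : nat -> R) :
  (forall i, (i < n)%nat -> 0 <= g i) -> 0 <= rsum n g.
Proof.
  intros H. replace 0 with (rsum n (fun _ => 0)) by (rewrite rsum_const; lra).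
  now apply rsum_le.
Qed.

Lemma rsum_swap (n m : nat) (g : nat -> nat -> R) :
  rsum n (fun i => rsum m (fun j => g i j)) = rsum m (fun j => rsum n (fun i => g i j)).
Proof.
  induction n as [|n IH]; simpl.
  - rewrite rsum_const; lra.
  - rewrite IH, <- rsum_plus. reflexivity.
Qed.

Lemma rsum_double (n : nat) (g : nat -> R) :
  rsum (2 * n) g = rsum n (fun j => g (2 * j)%nat + g (2 * j + 1)%nat).
Proof.
  induction n as [|n IH]; [reflexivity|].
  replace (2 * S n)%nat with (S (S (2 * n))) by lia.
  change (rsum (2 * n) g + g (2 * n)%nat + g (S (2 * n)) =
    rsum n (fun j => g (2 * j)%nat + g (2 * j + 1)%nat) + (g (2 * n)%nat + g (2 * n + 1)%nat)).
  rewrite IH, (Nat.add_1_r (2 * n)). lra.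
Qed.

Lemma rsum_shift (n : nat) (g : nat -> R) :
  rsum (S n) g = g O + rsum n (fun i => g (S i)).
Proof. induction n as [|n IH]; simpl in *; [lra|]. rewrite IH; lra. Qed.

Lemma rsum_indicator (n a b : nat) : (a <= b <= n)%nat ->
  rsum n (fun j => if andb (Nat.leb a j) (Nat.ltb j b) then 1 else 0) = INR (b - a).
Proof.
  intros Hab.
  (* Counting over an arbitrary initial segment frees the induction from the bound [b <= n]. *)
  assert (H : forall k, rsum k (fun j => if andb (Nat.leb a j) (Nat.ltb j b) then 1 else 0)
                = INR (Nat.min k b - Nat.min k a)).
  { induction k as [|k IH]; [reflexivity|]. simpl rsum. rewrite IH.
    destruct (Nat.leb_spec a k); destruct (Nat.ltb_spec k b); simpl andb; cbv iota.
    - replace (Nat.min (S k) b - Nat.min (S k) a)%nat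
        with (S (Nat.min k b - Nat.min k a)) by lia.
      rewrite S_INR; lra.
    - rewrite Rplus_0_r. f_equal. lia.
    - rewrite Rplus_0_r. f_equal. lia.
    - rewrite Rplus_0_r. f_equal. lia. }
  rewrite H. f_equal. lia.
Qed.

(** * Powers with the convention at 0, and the convexity inequalities *)

Lemma rpow_of_pos (x y : R) : 0 < x -> rpow x y = Rpower x y.
Proof. intros H. unfold rpow. destruct (Rle_dec x 0); [lra|reflexivity]. Qed.

Lemma rpow_0 (y : R) : rpow 0 y = 0.
Proof. unfold rpow. destruct (Rle_dec 0 0); [reflexivity|lra]. Qed.

Lemma rpow_gt0 (x y : R) : 0 < x -> 0 < rpow x y.
Proof. intros H. rewrite rpow_of_pos by exact H. apply exp_pos. Qed.

Lemma rpow_ge0 (x y : R) : 0 <= rpow x y.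
Proof. unfold rpow. destruct (Rle_dec x 0); [lra|left; apply exp_pos]. Qed.

Lemma rpow_1 (x : R) : 0 <= x -> rpow x 1 = x.
Proof.
  intros [H| <-]; [|apply rpow_0]. rewrite rpow_of_pos by exact H. now apply Rpower_1.
Qed.

Lemma rpow_mul_base (x y a : R) : 0 <= x -> 0 <= y ->
  rpow (x * y) a = rpow x a * rpow y a.
Proof.
  intros [Hx| <-] [Hy| <-]; rewrite ?Rmult_0_l, ?Rmult_0_r, ?rpow_0; try lra.
  rewrite !rpow_of_pos by (try apply Rmult_lt_0_compat; assumption).
  symmetry. now apply Rpower_mult_distr.
Qed.

Lemma rpow_plus (x a b : R) : rpow x (a + b) = rpow x a * rpow x b.
Proof.
  unfold rpow. destruct (Rle_dec x 0); [lra|apply Rpower_plus].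
Qed.

Lemma rpow_rpow (x a b : R) : rpow (rpow x a) b = rpow x (a * b).
Proof.
  destruct (Rle_dec x 0) as [H|H].
  - unfold rpow at 2 3. destruct (Rle_dec x 0); [apply rpow_0|lra].
  - rewrite (rpow_of_pos x) by lra. rewrite rpow_of_pos by apply exp_pos.
    rewrite rpow_of_pos by lra. apply Rpower_mult.
Qed.

Lemma rpow_opp (x a : R) : 0 < x -> rpow x a * rpow x (- a) = 1.
Proof.
  intros H. rewrite <- rpow_plus. replace (a + - a) with 0 by lra.
  rewrite rpow_of_pos by exact H. now apply Rpower_O.
Qed.

Lemma rpow_1_l (a : R) : rpow 1 a = 1.
Proof.
  rewrite rpow_of_pos by lra. unfold Rpower. rewrite ln_1, Rmult_0_r. apply exp_0.
Qed.

Lemma rpow_le (x y a : R) : 0 <= a -> 0 <= x <= y -> rpow x a <= rpow y a.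
Proof.
  intros Ha [[Hx| <-] Hxy]; [|rewrite rpow_0; apply rpow_ge0].
  rewrite !rpow_of_pos by lra. apply Rle_Rpower_l; lra.
Qed.

Lemma rpow_le_neg (x y a : R) : a <= 0 -> 0 < x <= y -> rpow y a <= rpow x a.
Proof.
  intros Ha [Hx Hxy].
  rewrite !rpow_of_pos by lra. unfold Rpower.
  assert (ln x <= ln y) by (destruct Hxy as [H| ->]; [left; now apply ln_increasing|lra]).
  assert (E : a * ln y <= a * ln x) by nra.
  destruct E as [E| ->]; [left; now apply exp_increasing|lra].
Qed.

Lemma rpow_2 (x : R) : 0 <= x -> rpow x 2 = x ^ 2.
Proof.
  intros H. replace 2 with (1 + 1) by lra. rewrite rpow_plus, rpow_1 by exact H. ring.
Qed.

(** [x + y] is at most twice the larger term, whose power is one of the two on the right; this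
    covers exponents on both sides of 1. *)
Lemma rpow_plus_le (x y a : R) : 0 < a -> 0 <= x -> 0 <= y ->
  rpow (x + y) a <= rpow 2 a * (rpow x a + rpow y a).
Proof.
  intros Ha Hx Hy.
  assert (Hmax : rpow (Rmax x y) a <= rpow x a + rpow y a).
  { pose proof (rpow_ge0 x a); pose proof (rpow_ge0 y a).
    unfold Rmax; destruct (Rle_dec x y); lra. }
  pose proof (Rmax_l x y); pose proof (Rmax_r x y).
  apply Rle_trans with (rpow (2 * Rmax x y) a).
  - apply rpow_le; lra.
  - rewrite rpow_mul_base by lra.
    apply Rmult_le_compat_l; [apply rpow_ge0|exact Hmax].
Qed.

(** Convexity of [exp]: its tangent line at the weighted mean [s] of [ln x] and [ln y] lies below
    the graph, and the linear terms cancel in the weighted sum. *)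
Lemma weighted_AM_GM (x y l : R) : 0 <= x -> 0 <= y -> 0 < l < 1 ->
  rpow x l * rpow y (1 - l) <= l * x + (1 - l) * y.
Proof.
  intros [Hx| <-] [Hy| <-] Hl; rewrite ?rpow_0; try nra.
  rewrite !rpow_of_pos by assumption. unfold Rpower. rewrite <- exp_plus.
  set (a := ln x). set (b := ln y).
  rewrite <- (exp_ln x Hx), <- (exp_ln y Hy). fold a b.
  set (s := l * a + (1 - l) * b).
  assert (T : forall c, exp s * (1 + (c - s)) <= exp c).
  { intros c. replace (exp c) with (exp s * exp (c - s)).
    - apply Rmult_le_compat_l; [left; apply exp_pos|apply exp_ineq1_le].
    - rewrite <- exp_plus. f_equal. ring. }
  pose proof (T a); pose proof (T b).
  assert (exp s = l * (exp s * (1 + (a - s))) + (1 - l) * (exp s * (1 + (b - s)))).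
  { unfold s. ring. }
  nra.
Qed.

(** After normalization by [A] and [B], each term falls to the weighted AM-GM inequality. Positive
    upper bounds stand in for the sums themselves, which may vanish. *)
Lemma rsum_Hoelder (n : nat) (a b : nat -> R) (A B l : R) :
  0 < l < 1 -> 0 < A -> 0 < B ->
  (forall i, (i < n)%nat -> 0 <= a i) -> (forall i, (i < n)%nat -> 0 <= b i) ->
  rsum n a <= A -> rsum n b <= B ->
  rsum n (fun i => rpow (a i) l * rpow (b i) (1 - l)) <= rpow A l * rpow B (1 - l).
Proof.
  intros Hl HA HB Ha Hb Sa Sb.
  assert (E : forall i, (i < n)%nat -> rpow (a i) l * rpow (b i) (1 - l) <=
     (rpow A l * rpow B (1 - l)) * (l * / A * a i + (1 - l) * / B * b i)).
  { intros i Hi.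
    assert (HA' := Rinv_0_lt_compat _ HA). assert (HB' := Rinv_0_lt_compat _ HB).
    assert (Ea : rpow (a i) l = rpow A l * rpow (/ A * a i) l).
    { rewrite <- rpow_mul_base; [f_equal; field; lra|lra|].
      apply Rmult_le_pos; [lra|auto]. }
    assert (Eb : rpow (b i) (1 - l) = rpow B (1 - l) * rpow (/ B * b i) (1 - l)).
    { rewrite <- rpow_mul_base; [f_equal; field; lra|lra|].
      apply Rmult_le_pos; [lra|auto]. }
    rewrite Ea, Eb.
    replace (rpow A l * rpow (/ A * a i) l * (rpow B (1 - l) * rpow (/ B * b i) (1 - l)))
      with (rpow A l * rpow B (1 - l) * (rpow (/ A * a i) l * rpow (/ B * b i) (1 - l))) by ring.
    apply Rmult_le_compat_l; [apply Rmult_le_pos; apply rpow_ge0|].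
    rewrite !Rmult_assoc. apply weighted_AM_GM; auto; apply Rmult_le_pos; auto; lra. }
  apply Rle_trans with (1 := rsum_le _ _ _ E).
  rewrite rsum_scal, rsum_plus, !rsum_scal.
  rewrite <- (Rmult_1_r (rpow A l * rpow B (1 - l))) at 2.
  apply Rmult_le_compat_l; [apply Rmult_le_pos; apply rpow_ge0|].
  assert (/ A * rsum n a <= 1).
  { apply Rmult_le_reg_l with A; [lra|]. rewrite <- Rmult_assoc, Rinv_r; lra. }
  assert (/ B * rsum n b <= 1).
  { apply Rmult_le_reg_l with B; [lra|]. rewrite <- Rmult_assoc, Rinv_r; lra. }
  nra.
Qed.

(** The right side is the integral of [s^(k-1)] over [[a,b]], whose integrand is least at [b].
    Algebraically it is weighted AM-GM for [a] and [b], divided by [b^(1-k)]. *)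
Lemma rpow_increment (a b k : R) : 0 < a <= b -> 0 < k < 1 ->
  rpow b (k - 1) * (b - a) <= / k * (rpow b k - rpow a k).
Proof.
  intros Hab Hk.
  pose proof (weighted_AM_GM a b k ltac:(lra) ltac:(lra) Hk) as H.
  assert (Hb : 0 < rpow b (k - 1)) by (apply rpow_gt0; lra).
  apply (Rmult_le_compat_r (rpow b (k - 1))) in H; [|lra].
  rewrite Rmult_assoc in H.
  assert (E : rpow b (1 - k) * rpow b (k - 1) = 1).
  { replace (k - 1) with (- (1 - k)) by ring. apply rpow_opp; lra. }
  rewrite E in H.
  assert (E2 : rpow b (k - 1) * b = rpow b k).
  { rewrite <- (rpow_1 b) at 2 by lra. rewrite <- rpow_plus. f_equal; ring. }
  apply Rmult_le_reg_l with k; [lra|].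
  rewrite <- (Rmult_assoc k (/ k)), Rinv_r by lra. nra.
Qed.

(** * Banach space arithmetic and Rademacher averages *)

Lemma badd_interchange (X : Banach) (a b c d : X) :
  badd X (badd X a b) (badd X c d) = badd X (badd X a c) (badd X b d).
Proof.
  rewrite <- !badd_assoc. f_equal. rewrite !badd_assoc. f_equal. apply badd_comm.
Qed.

Lemma badd_0_l (X : Banach) (x : X) : badd X (bzero X) x = x.
Proof. rewrite badd_comm. apply badd_zero. Qed.

Lemma bscal_0_l (X : Banach) (x : X) : bscal X 0 x = bzero X.
Proof.
  assert (H : badd X (bscal X 0 x) (bscal X 0 x) = bscal X 0 x).
  { rewrite <- bscal_distr_r. f_equal. lra. }
  rewrite <- (badd_opp X (bscal X 0 x)). rewrite <- H at 2.
  rewrite <- badd_assoc, badd_opp, badd_zero. reflexivity.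
Qed.

Lemma bscal_0_r (X : Banach) (a : R) : bscal X a (bzero X) = bzero X.
Proof. rewrite <- (bscal_0_l X (bzero X)), bscal_assoc. f_equal. lra. Qed.

Lemma bnorm_0 (X : Banach) : bnorm X (bzero X) = 0.
Proof. rewrite <- (bscal_0_l X (bzero X)), bnorm_scal, Rabs_R0. lra. Qed.

(** Not an axiom of [Banach]: it comes from the triangle inequality for [x] and its opposite. *)
Lemma bnorm_ge0 (X : Banach) (x : X) : 0 <= bnorm X x.
Proof.
  pose proof (bnorm_triangle X x (bscal X (-1) x)) as H.
  rewrite bnorm_scal, <- (bscal_one X x) in H at 1.
  rewrite <- bscal_distr_r in H. replace (1 + -1) with 0 in H by lra.
  rewrite bscal_0_l, bnorm_0, Rabs_left in H by lra. lra.
Qed.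

(* [rad2 m y x] is the second moment of the norm of [x + sum_(i<m) r_i y_i]. *)
Fixpoint rad2 {X : Banach} (m : nat) (y : nat -> X) (x : X) : R :=
  match m with
  | O => bnorm X x ^ 2
  | S m' => (rad2 m' (fun i => y (S i)) (badd X x (y O)) +
             rad2 m' (fun i => y (S i)) (badd X x (bscal X (-1) (y O)))) / 2
  end.

Lemma rad2_ge0 (X : Banach) (m : nat) : forall (y : nat -> X) (x : X), 0 <= rad2 m y x.
Proof.
  induction m as [|m IH]; intros y x; simpl.
  - nra.
  - pose proof (IH (fun i => y (S i)) (badd X x (y O))).
    pose proof (IH (fun i => y (S i)) (badd X x (bscal X (-1) (y O)))). lra.
Qed.

Lemma rad2_ext (X : Banach) (m : nat) : forall (y z : nat -> X) (x : X),
  (forall i, (i < m)%nat -> y i = z i) -> rad2 m y x = rad2 m z x.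
Proof.
  induction m as [|m IH]; intros y z x H; simpl; [reflexivity|].
  rewrite (H O) by lia.
  rewrite !(IH (fun i => y (S i)) (fun i => z (S i))) by (intros; apply H; lia). reflexivity.
Qed.

Lemma rad2_scal (X : Banach) (c : R) (m : nat) : forall (y : nat -> X) (x : X),
  rad2 m (fun i => bscal X c (y i)) (bscal X c x) = c ^ 2 * rad2 m y x.
Proof.
  induction m as [|m IH]; intros y x; cbn [rad2].
  - rewrite bnorm_scal, Rpow_mult_distr, <- (pow2_abs c). reflexivity.
  - rewrite bscal_assoc, (Rmult_comm (-1) c), <- bscal_assoc, <- !bscal_distr_l, !IH. field.
Qed.

(** The square of a norm is convex, and averaging over signs preserves convexity. *)
Lemma rad2_convex (X : Banach) (a b : R) (m : nat) : 0 <= a -> 0 <= b -> a + b = 1 ->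
  forall (y : nat -> X) (u v : X),
  rad2 m y (badd X (bscal X a u) (bscal X b v)) <= a * rad2 m y u + b * rad2 m y v.
Proof.
  intros Ha Hb Hab. induction m as [|m IH]; intros y u v; cbn [rad2].
  - pose proof (bnorm_triangle X (bscal X a u) (bscal X b v)) as H.
    rewrite !bnorm_scal, !Rabs_pos_eq in H by assumption.
    pose proof (bnorm_ge0 X (badd X (bscal X a u) (bscal X b v))).
    apply Rle_trans with ((a * bnorm X u + b * bnorm X v) ^ 2).
    + apply pow_incr; lra.
    + replace b with (1 - a) by lra.
      assert (0 <= a * b * (bnorm X u - bnorm X v) ^ 2)
        by (apply Rmult_le_pos; [now apply Rmult_le_pos|apply pow2_ge_0]).
      replace b with (1 - a) in * by lra. lra.
  - assert (E : forall w, badd X (badd X (bscal X a u) (bscal X b v)) w =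
      badd X (bscal X a (badd X u w)) (bscal X b (badd X v w))).
    { intros w. rewrite !bscal_distr_l, badd_interchange, <- bscal_distr_r, Hab, bscal_one.
      reflexivity. }
    rewrite !E.
    pose proof (IH (fun i => y (S i)) (badd X u (y O)) (badd X v (y O))).
    pose proof (IH (fun i => y (S i)) (badd X u (bscal X (-1) (y O)))
                  (badd X v (bscal X (-1) (y O)))).
    lra.
Qed.

(** Kahane's contraction principle. The vector [x + a z] is a convex combination of [x + z] and
    [x - z] with weights [(1+a)/2] and [(1-a)/2]; for [x - a z] the weights are swapped, so the
    average over both signs does not increase. *)
Lemma rad2_contraction (X : Banach) (m : nat) : forall (y z : nat -> X) (x : X),
  (forall i, (i < m)%nat -> exists a, Rabs a <= 1 /\ y i = bscal X a (z i)) ->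
  rad2 m y x <= rad2 m z x.
Proof.
  induction m as [|m IH]; intros y z x H; cbn [rad2]; [lra|].
  destruct (H O ltac:(lia)) as [a [Ha Ea]]. rewrite Ea.
  assert (Hs : forall w, rad2 m (fun i => y (S i)) w <= rad2 m (fun i => z (S i)) w)
    by (intros w; apply IH; intros; apply H; lia).
  assert (Ha1 := Rle_abs a). assert (Ha2 := Rle_abs (- a)). rewrite Rabs_Ropp in Ha2.
  assert (E : forall b, badd X x (bscal X b (z O)) =
    badd X (bscal X ((1 + b) / 2) (badd X x (z O)))
           (bscal X ((1 - b) / 2) (badd X x (bscal X (-1) (z O))))).
  { intros b. rewrite !bscal_distr_l, badd_interchange, bscal_assoc, <- !bscal_distr_r.
    rewrite <- (bscal_one X x) at 1. f_equal; f_equal; field. }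
  rewrite bscal_assoc.
  pose proof (Hs (badd X x (bscal X a (z O)))) as H1.
  pose proof (Hs (badd X x (bscal X (-1 * a) (z O)))) as H2.
  pose proof (rad2_convex X ((1 + a) / 2) ((1 - a) / 2) m ltac:(lra) ltac:(lra) ltac:(lra)
    (fun i => z (S i)) (badd X x (z O)) (badd X x (bscal X (-1) (z O)))) as C1.
  pose proof (rad2_convex X ((1 + -1 * a) / 2) ((1 - -1 * a) / 2) m
    ltac:(lra) ltac:(lra) ltac:(lra)
    (fun i => z (S i)) (badd X x (z O)) (badd X x (bscal X (-1) (z O)))) as C2.
  rewrite <- E in C1, C2. lra.
Qed.

Lemma quadratic_mean_triangle (a b c d : R) : 0 <= a -> 0 <= b -> 0 <= c -> 0 <= d ->
  sqrt (((a + c) ^ 2 + (b + d) ^ 2) / 2) <=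
  sqrt ((a ^ 2 + b ^ 2) / 2) + sqrt ((c ^ 2 + d ^ 2) / 2).
Proof.
  intros. set (s := sqrt ((a ^ 2 + b ^ 2) / 2)). set (r := sqrt ((c ^ 2 + d ^ 2) / 2)).
  assert (Hs : 0 <= s) by apply sqrt_pos. assert (Hr : 0 <= r) by apply sqrt_pos.
  assert (Es : s * s = (a ^ 2 + b ^ 2) / 2) by (apply sqrt_sqrt; nra).
  assert (Er : r * r = (c ^ 2 + d ^ 2) / 2) by (apply sqrt_sqrt; nra).
  rewrite <- (sqrt_square (s + r)) by lra. apply sqrt_le_1_alt.
  assert (a * c + b * d <= 2 * (s * r)).
  { apply Rsqr_incr_0_var; [|nra]. unfold Rsqr.
    replace (2 * (s * r) * (2 * (s * r))) with (4 * (s * s) * (r * r)) by ring.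
    rewrite Es, Er. pose proof (pow2_ge_0 (a * d - b * c)). lra. }
  replace ((s + r) * (s + r)) with (s * s + r * r + 2 * (s * r)) by ring.
  rewrite Es, Er. lra.
Qed.

(** Minkowski's inequality for square-integrable [X]-valued functions: each further sign is a
    two-point quadratic mean. *)
Lemma rad2_triangle (X : Banach) (m : nat) : forall (y z : nat -> X) (u v : X),
  sqrt (rad2 m (fun i => badd X (y i) (z i)) (badd X u v)) <=
  sqrt (rad2 m y u) + sqrt (rad2 m z v).
Proof.
  induction m as [|m IH]; intros y z u v; cbn [rad2].
  - rewrite !sqrt_pow2 by apply bnorm_ge0. apply bnorm_triangle.
  - rewrite bscal_distr_l, !(badd_interchange X u v).
    pose proof (IH (fun i => y (S i)) (fun i => z (S i)) (badd X u (y O)) (badd X v (z O))) as H1.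
    pose proof (IH (fun i => y (S i)) (fun i => z (S i))
      (badd X u (bscal X (-1) (y O))) (badd X v (bscal X (-1) (z O)))) as H2.
    cbv beta in H1, H2 |- *.
    (* Each average is rewritten as the square of its root, the form that [quadratic_mean_triangle]
       requires. *)
    repeat match goal with
    | |- context [rad2 m ?g ?x] =>
      let s := fresh "s" in let E := fresh "E" in
      remember (sqrt (rad2 m g x)) as s eqn:E;
      assert (0 <= s) by (rewrite E; apply sqrt_pos);
      replace (rad2 m g x) with (s ^ 2) by (rewrite E; apply pow2_sqrt; apply rad2_ge0);
      clear E
    end.
    eapply Rle_trans; [|apply quadratic_mean_triangle; assumption].
    apply sqrt_le_1_alt.
    assert (s ^ 2 <= (s1 + s3) ^ 2) by (apply pow_incr; lra).
    assert (s0 ^ 2 <= (s2 + s4) ^ 2) by (apply pow_incr; lra). lra.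
Qed.

(** Orthonormality of the signs: along a unit vector the average is scalar, and the cross terms of
    [b + a O] and [b - a O] cancel. *)
Lemma rad2_scalar (X : Banach) (e : X) (m : nat) : bnorm X e = 1 ->
  forall (a : nat -> R) (b : R),
  rad2 m (fun i => bscal X (a i) e) (bscal X b e) = b ^ 2 + rsum m (fun i => a i ^ 2).
Proof.
  intros He. induction m as [|m IH]; intros a b.
  - simpl rsum. unfold rad2. rewrite bnorm_scal, He, Rmult_1_r, pow2_abs. lra.
  - rewrite rsum_shift. cbn [rad2].
    rewrite bscal_assoc, <- !bscal_distr_r, !(IH (fun i => a (S i))). field.
Qed.


(** * Square functions as Rademacher averages *)

Lemma signed_sum_shift (X : Banach) (t : R) (f : haar_series X) : forall j i,
  signed_sum f j (S i) t = signed_sum f (Nat.div2 j) i t.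
Proof.
  induction f as [|a f IH]; intros j i; simpl; [reflexivity|].
  rewrite IH. reflexivity.
Qed.

(** The vector [x] carries the terms whose signs are already fixed. Patterns [2j] and [2j+1] differ
    only in the sign of the first term, which is the recursion of [rad2]. *)
Lemma sign_average_rad2 (X : Banach) (t : R) (d : Dyad * X) (f : haar_series X) : forall x : X,
  / 2 ^ length f * rsum (2 ^ length f) (fun j => bnorm X (badd X x (signed_sum f j 0 t)) ^ 2) =
  rad2 (length f) (fun i => bscal X (haar (fst (nth i f d)) t) (snd (nth i f d))) x.
Proof.
  induction f as [|a f IH]; intros x.
  - cbn [length rad2 signed_sum]. rewrite badd_zero. cbn. field.
  - change (2 ^ length (a :: f))%nat with (2 * 2 ^ length f)%nat.
    rewrite rsum_double. cbn [length rad2 nth].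
    rewrite <- !IH.
    rewrite (rsum_ext _ _ (fun j =>
      bnorm X (badd X (badd X x (bscal X (haar (fst a) t) (snd a))) (signed_sum f j 0 t)) ^ 2 +
      bnorm X (badd X (badd X x (bscal X (-1) (bscal X (haar (fst a) t) (snd a))))
        (signed_sum f j 0 t)) ^ 2)).
    + rewrite rsum_plus. simpl pow. field. apply pow_nonzero. lra.
    + intros j _. cbn [signed_sum]. rewrite !signed_sum_shift.
      rewrite Nat.add_1_r, Nat.div2_double, Nat.div2_succ_double.
      unfold sgn. rewrite Nat.testbit_even_0, <- (Nat.add_1_r (2 * j)), Nat.testbit_odd_0.
      rewrite Rmult_1_l, bscal_assoc, !badd_assoc. reflexivity.
Qed.

(** With intervals and coefficients as functions of an index, reweighting and rearrangement act
    termwise rather than on a list. *)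
Definition indexed_series {X : Banach} (I : nat -> Dyad) (x : nat -> X) (m : nat) : haar_series X :=
  map (fun i => (I i, x i)) (seq 0 m).

Lemma mk_nth (X : Banach) (d : Dyad * X) (f : haar_series X) :
  f = indexed_series (fun i => fst (nth i f d)) (fun i => snd (nth i f d)) (length f).
Proof.
  unfold indexed_series. apply nth_ext with d d; [now rewrite length_map, length_seq|].
  intros i Hi.
  set (g := fun i0 => (fst (nth i0 f d), snd (nth i0 f d))).
  rewrite (nth_indep (map g _) d (g O)) by now rewrite length_map, length_seq.
  rewrite map_nth, seq_nth by exact Hi. unfold g. now destruct (nth (0 + i) f d) eqn:E.
Qed.

Lemma sqfun_mk (X : Banach) (I : nat -> Dyad) (x : nat -> X) (m : nat) (t : R) :
  sqfun (indexed_series I x m) t = sqrt (rad2 m (fun i => bscal X (haar (I i) t) (x i)) (bzero X)).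
Proof.
  unfold sqfun. f_equal.
  rewrite (rsum_ext _ _ (fun j => bnorm X (badd X (bzero X) (signed_sum (indexed_series I x m) j 0 t)) ^ 2))
    by (intros; now rewrite badd_0_l).
  rewrite (sign_average_rad2 X t (I O, x O)).
  replace (length (indexed_series I x m)) with m by (unfold indexed_series; now rewrite length_map, length_seq).
  apply rad2_ext. intros i Hi. unfold indexed_series.
  rewrite (map_nth (fun i => (I i, x i))), seq_nth by exact Hi. reflexivity.
Qed.

Lemma sqfun_ge0 (X : Banach) (f : haar_series X) (t : R) : 0 <= sqfun f t.
Proof. apply sqrt_pos. Qed.

Lemma sqfun_scalar (X : Banach) (e : X) (I : nat -> Dyad) (a : nat -> R) (m : nat) (t : R) :
  bnorm X e = 1 ->
  sqfun (indexed_series I (fun i => bscal X (a i) e) m) t ^ 2 = rsum m (fun i => a i ^ 2 * haar (I i) t ^ 2).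
Proof.
  intros He. rewrite sqfun_mk, pow2_sqrt by apply rad2_ge0.
  rewrite (rad2_ext X m _ (fun i => bscal X (haar (I i) t * a i) e))
    by (intros; apply bscal_assoc).
  rewrite <- (bscal_0_l X e), rad2_scalar by exact He.
  rewrite pow_i, Rplus_0_l by lia. apply rsum_ext. intros; ring.
Qed.

(** The contraction principle at one point: a term whose Haar factor vanishes at [t] is zero, so its
    multiplier needs no control. *)
Lemma sqfun_contraction (X : Banach) (I : nat -> Dyad) (x z : nat -> X) (m : nat) (t c : R) :
  0 <= c ->
  (forall i, (i < m)%nat -> haar (I i) t <> 0 ->
     exists a, Rabs a <= c /\ x i = bscal X a (z i)) ->
  sqfun (indexed_series I x m) t <= c * sqfun (indexed_series I z m) t.
Proof.
  intros Hc H. rewrite !sqfun_mk.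
  rewrite <- (sqrt_pow2 c) at 1 by exact Hc.
  rewrite <- sqrt_mult_alt by apply pow2_ge_0.
  rewrite <- rad2_scal, bscal_0_r. apply sqrt_le_1_alt, rad2_contraction.
  intros i Hi. destruct (Req_dec (haar (I i) t) 0) as [E|E].
  - exists 0. rewrite Rabs_R0. split; [lra|]. now rewrite E, !bscal_0_l.
  - destruct (H i Hi E) as [a [Ha ->]]. destruct (Req_dec c 0) as [->|Hc0].
    + exists 0. rewrite Rabs_R0. split; [lra|].
      assert (a = 0) as -> by (destruct (Req_dec a 0) as [|Ha0]; [assumption|];
        pose proof (Rabs_pos_lt a Ha0); lra).
      now rewrite !bscal_0_l, bscal_0_r.
    + exists (a / c). split.
      * unfold Rdiv. rewrite Rabs_mult, Rabs_inv, (Rabs_pos_eq c) by lra.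
        apply Rmult_le_reg_r with c; [lra|]. rewrite Rmult_assoc, Rinv_l; lra.
      * rewrite !bscal_assoc. f_equal. field. exact Hc0.
Qed.

Lemma sqfun_scal (X : Banach) (I : nat -> Dyad) (x : nat -> X) (m : nat) (t c : R) :
  0 <= c -> sqfun (indexed_series I (fun i => bscal X c (x i)) m) t = c * sqfun (indexed_series I x m) t.
Proof.
  intros Hc. rewrite !sqfun_mk.
  rewrite <- (sqrt_pow2 c) at 1 by exact Hc.
  rewrite <- sqrt_mult_alt by apply pow2_ge_0.
  rewrite <- rad2_scal, bscal_0_r. f_equal. apply rad2_ext. intros i _.
  rewrite !bscal_assoc. f_equal. ring.
Qed.

(** * Abel summation over the levels *)

Definition level_mask {X : Banach} (lev : nat -> nat) (n : nat) (y : nat -> X) (i : nat) : X :=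
  if Nat.leb (lev i) n then y i else bzero X.

(** Induction on the top level: subtracting the smallest weight [w (S n)] from all others leaves
    nonnegative nonincreasing weights on the levels up to [n], and the subtracted part is a multiple
    of the truncation at [S n]. *)
Lemma rad2_Abel (X : Banach) (m : nat) (lev : nat -> nat) (y : nat -> X) :
  let s := fun n => sqrt (rad2 m (level_mask lev n y) (bzero X)) in
  forall (n : nat) (w : nat -> R),
  (forall k, (k <= n)%nat -> 0 <= w k) -> (forall k, (k < n)%nat -> w (S k) <= w k) ->
  sqrt (rad2 m (level_mask lev n (fun i => bscal X (w (lev i)) (y i))) (bzero X)) <=
  w O * s O + rsum n (fun k => w (S k) * (s (S k) - s k)).
Proof.
  intros s. induction n as [|n IH]; intros w Hw Hd.
  - simpl rsum. rewrite Rplus_0_r. unfold s.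
    rewrite <- (sqrt_pow2 (w O)) at 1 by (apply Hw; lia).
    rewrite <- sqrt_mult_alt by apply pow2_ge_0.
    rewrite <- rad2_scal, bscal_0_r. right. f_equal. apply rad2_ext.
    intros i _. unfold level_mask. destruct (Nat.leb_spec (lev i) 0).
    + now replace (lev i) with O by lia.
    + now rewrite bscal_0_r.
  - set (w' := fun k => w k - w (S n)).
    assert (Hmono : forall k, (k <= S n)%nat -> w (S n) <= w k).
    { intros k Hk. assert (forall l, (k + l <= S n)%nat -> w (k + l)%nat <= w k) as Q.
      { induction l as [|l IHl]; intros Hl; [rewrite Nat.add_0_r; lra|].
        rewrite Nat.add_succ_r. apply Rle_trans with (w (k + l)%nat).
        - apply Hd. lia.
        - apply IHl. lia. }
      replace (S n) with (k + (S n - k))%nat by lia. apply Q. lia. }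
    rewrite (rad2_ext X m _ (fun i => badd X
      (level_mask lev n (fun i => bscal X (w' (lev i)) (y i)) i)
      (bscal X (w (S n)) (level_mask lev (S n) y i)))).
    + rewrite <- (badd_zero X (bzero X)).
      apply Rle_trans with (1 := rad2_triangle _ _ _ _ _ _).
      rewrite <- (bscal_0_r X (w (S n))) at 2. rewrite rad2_scal.
      rewrite sqrt_mult_alt, sqrt_pow2 by (try apply pow2_ge_0; apply Hw; lia).
      fold (s (S n)).
      assert (H := IH w'). unfold w' in H at 1 2 3.
      specialize (H ltac:(intros k Hk; specialize (Hmono k ltac:(lia)); lra)
                    ltac:(intros k Hk; specialize (Hd k ltac:(lia)); lra)).
      (* Passing from [w] to [w'] changes the sum by a telescoping amount. *)
      assert (T : w' O * s O + rsum n (fun k => w' (S k) * (s (S k) - s k)) =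
        w O * s O + rsum n (fun k => w (S k) * (s (S k) - s k)) - w (S n) * s n).
      { unfold w'. clear. generalize (w (S n)) as c. intros c.
        induction n as [|n IH]; simpl; [ring|].
        rewrite <- Rplus_assoc, IH. ring. }
      rewrite T in H. simpl rsum. lra.
    + intros i _. unfold level_mask.
      destruct (Nat.leb_spec (lev i) n); destruct (Nat.leb_spec (lev i) (S n)); try lia.
      * rewrite <- bscal_distr_r. unfold w'. f_equal. ring.
      * replace (lev i) with (S n) by lia. now rewrite badd_0_l.
      * now rewrite bscal_0_r, badd_zero.
Qed.

(** Abel summation with weights [(d + s)^(k-1)], nonincreasing because [k < 1]; [rpow_increment]
    makes the increments telescope. A positive [d] keeps the bases away from 0, where [rpow] is 0
    even for negative exponents. *)
Lemma rad2_weighted (X : Banach) (m : nat) (lev : nat -> nat) (y : nat -> X) (d k : R) :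
  let s := fun n => sqrt (rad2 m (level_mask lev n y) (bzero X)) in
  0 < d -> 0 < k < 1 ->
  sqrt (rad2 m (fun i => bscal X (rpow (d + s (lev i)) (k - 1)) (y i)) (bzero X)) <=
  / k * rpow (d + sqrt (rad2 m y (bzero X))) k.
Proof.
  intros s Hd Hk.
  (* Truncation at a common bound [n] of the levels is the whole series. *)
  assert (Hb : exists n, forall i, (i < m)%nat -> (lev i <= n)%nat).
  { clear. induction m as [|m [n Hn]]; [exists O; lia|].
    exists (Nat.max n (lev m)). intros i Hi.
    destruct (Nat.eq_dec i m) as [->|]; [lia|]. specialize (Hn i ltac:(lia)). lia. }
  destruct Hb as [n Hn].
  assert (Hs0 : forall j, 0 <= s j) by (intros; apply sqrt_pos).
  assert (Hs : forall j, s j <= s (S j)).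
  { intros j. apply sqrt_le_1_alt, rad2_contraction. intros i _. unfold level_mask.
    destruct (Nat.leb_spec (lev i) j); destruct (Nat.leb_spec (lev i) (S j)); try lia.
    - exists 1. rewrite Rabs_R1, bscal_one. split; [lra|reflexivity].
    - exists 0. rewrite Rabs_R0, bscal_0_l. split; [lra|reflexivity].
    - exists 0. rewrite Rabs_R0, bscal_0_l. split; [lra|reflexivity]. }
  set (w := fun j => rpow (d + s j) (k - 1)).
  pose proof (rad2_Abel X m lev y n w) as H. cbv zeta in H. fold s in H.
  assert (Hw : forall j, (j <= n)%nat -> 0 <= w j) by (intros; apply rpow_ge0).
  specialize (H Hw).
  assert (Hdec : forall j, (j < n)%nat -> w (S j) <= w j).
  { intros j _. apply rpow_le_neg; [lra|]. specialize (Hs j). specialize (Hs0 j). lra. }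
  specialize (H Hdec).
  rewrite (rad2_ext X m _ (fun i => bscal X (w (lev i)) (y i))) in H
    by (intros i Hi; unfold level_mask; specialize (Hn i Hi);
        destruct (Nat.leb_spec (lev i) n); [reflexivity|lia]).
  apply Rle_trans with (1 := H).
  replace (sqrt (rad2 m y (bzero X))) with (s n)
    by (unfold s; f_equal; apply rad2_ext; intros i Hi; unfold level_mask;
        specialize (Hn i Hi); destruct (Nat.leb_spec (lev i) n); [reflexivity|lia]).
  assert (T : forall n, w O * s O + rsum n (fun j => w (S j) * (s (S j) - s j)) <=
                / k * (rpow (d + s n) k - rpow d k)).
  { clear -Hs Hs0 Hd Hk. induction n as [|n IH]; simpl rsum.
    - pose proof (rpow_increment d (d + s O) k) as Q. specialize (Hs0 O).
      replace (d + s O - d) with (s O) in Q by ring. specialize (Q ltac:(lra) Hk).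
      unfold w. lra.
    - pose proof (rpow_increment (d + s n) (d + s (S n)) k) as Q.
      specialize (Hs n). specialize (Hs0 n).
      replace (d + s (S n) - (d + s n)) with (s (S n) - s n) in Q by ring.
      specialize (Q ltac:(lra) Hk). fold (w (S n)) in Q. lra. }
  apply Rle_trans with (1 := T n).
  apply Rmult_le_compat_l; [left; apply Rinv_0_lt_compat; lra|].
  pose proof (rpow_ge0 d k). lra.
Qed.

(** * Dyadic intervals and Haar functions at a point *)

Lemma dyadic_mem_nat (k n s pos : nat) (t : R) : (k <= n)%nat ->
  INR pos * / 2 ^ n <= t < (INR pos + 1) * / 2 ^ n ->
  (INR s * / 2 ^ k <= t < (INR s + 1) * / 2 ^ k <->
   (s * 2 ^ (n - k) <= pos < (s + 1) * 2 ^ (n - k))%nat).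
Proof.
  intros Hkn [H1 H2].
  assert (Hn : 0 < / 2 ^ n) by (apply Rinv_0_lt_compat, pow_lt; lra).
  assert (E : / 2 ^ k = INR (2 ^ (n - k)) * / 2 ^ n).
  { replace n with ((n - k) + k)%nat at 2 by lia.
    rewrite pow_INR, pow_add. change (INR 2) with 2. field.
    split; apply pow_nonzero; lra. }
  (* An endpoint of the coarse grid belongs to the fine grid too, so it cannot fall strictly inside
     the cell of [t]. *)
  assert (Q : forall a : nat, INR a * / 2 ^ k <= t <-> (a * 2 ^ (n - k) <= pos)%nat).
  { intros a. rewrite E, <- Rmult_assoc, <- mult_INR. split; intros H.
    - apply Nat.nlt_ge. intros H'. apply le_INR in H'. rewrite S_INR in H'.
      apply (Rmult_le_compat_r (/ 2 ^ n)) in H'; lra.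
    - apply le_INR in H. apply (Rmult_le_compat_r (/ 2 ^ n)) in H; lra. }
  rewrite (Q s). replace (INR s + 1) with (INR (s + 1)) by (rewrite plus_INR; reflexivity).
  assert (Q' := Q (s + 1)%nat). split; intros [Ha Hb]; split; auto.
  - apply Nat.nle_gt. intros H. apply Q' in H. lra.
  - apply Rnot_le_lt. intros H. apply Q' in H. lia.
Qed.

Definition dmem (I : Dyad) (t : R) : Prop :=
  INR (dpos I) * dlen I <= t < (INR (dpos I) + 1) * dlen I.

Definition dleft (I : Dyad) : R := INR (dpos I) * dlen I.

Lemma dlen_gt0 (I : Dyad) : 0 < dlen I.
Proof. apply Rinv_0_lt_compat, pow_lt; lra. Qed.

Lemma haar_mem (I : Dyad) (t : R) : dmem I t -> haar I t = 1 \/ haar I t = -1.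
Proof.
  unfold dmem, haar. intros [H1 H2].
  destruct (Rle_dec _ t); [|lra]. destruct (Rlt_dec t _); [now left|].
  destruct (Rlt_dec t _); [now right|lra].
Qed.

Lemma haar_nmem (I : Dyad) (t : R) : ~ dmem I t -> haar I t = 0.
Proof.
  unfold dmem, haar. intros H. pose proof (dlen_gt0 I).
  destruct (Rle_dec _ t); [|reflexivity].
  destruct (Rlt_dec t _); [exfalso; apply H; nra|].
  destruct (Rlt_dec t _); [exfalso; apply H; nra|reflexivity].
Qed.

Lemma haar_neq0_mem (I : Dyad) (t : R) : haar I t <> 0 -> dmem I t.
Proof.
  intros H. unfold dmem.
  destruct (Rle_dec (INR (dpos I) * dlen I) t) as [H1|H1];
  destruct (Rlt_dec t ((INR (dpos I) + 1) * dlen I)) as [H2|H2]; try (split; assumption);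
  exfalso; apply H, haar_nmem; unfold dmem; lra.
Qed.

(** The square of a Haar function is the indicator of its interval. *)
Lemma haar_sqr_eq (I K : Dyad) (t u : R) : (dmem I t <-> dmem K u) ->
  haar I t ^ 2 = haar K u ^ 2.
Proof.
  intros H. destruct (Req_dec (haar I t) 0) as [E|E].
  - destruct (Req_dec (haar K u) 0) as [E'|E']; [now rewrite E, E'|].
    apply haar_neq0_mem, H, haar_mem in E'. lra.
  - apply haar_neq0_mem in E. destruct (haar_mem I t E) as [-> | ->];
    apply H, haar_mem in E; destruct E as [-> | ->]; ring.
Qed.

Lemma haar_sqr_const (I K : Dyad) (t : R) : (dlevel K <= dlevel I)%nat -> dmem I t ->
  haar K t ^ 2 = haar K (dleft I) ^ 2.
Proof.
  intros H Ht. apply haar_sqr_eq. unfold dmem at 1 2.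
  unfold dlen. rewrite (dyadic_mem_nat _ (dlevel I) _ (dpos I)); [|exact H|exact Ht].
  rewrite (dyadic_mem_nat _ (dlevel I) _ (dpos I)); [reflexivity|exact H|].
  unfold dleft. pose proof (dlen_gt0 I). fold (dlen I). lra.
Qed.

(** * Integrals of functions constant on dyadic cells, as finite means *)

Definition dyadic_mean (N : nat) (g : R -> R) : R :=
  rsum (2 ^ N) (fun j => / 2 ^ N * g (INR j / 2 ^ N)).

Lemma avg_le (N : nat) (g h : R -> R) : (forall t, g t <= h t) -> dyadic_mean N g <= dyadic_mean N h.
Proof.
  intros H. apply rsum_le. intros j _. apply Rmult_le_compat_l; [|apply H].
  left. apply Rinv_0_lt_compat, pow_lt. lra.
Qed.

Lemma avg_ext (N : nat) (g h : R -> R) : (forall t, g t = h t) -> dyadic_mean N g = dyadic_mean N h.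
Proof. intros H. apply rsum_ext. intros; now rewrite H. Qed.

Lemma avg_plus (N : nat) (g h : R -> R) : dyadic_mean N (fun t => g t + h t) = dyadic_mean N g + dyadic_mean N h.
Proof. unfold dyadic_mean. rewrite <- rsum_plus. apply rsum_ext. intros; ring. Qed.

Lemma avg_scal (N : nat) (c : R) (g : R -> R) : dyadic_mean N (fun t => c * g t) = c * dyadic_mean N g.
Proof. unfold dyadic_mean. rewrite <- rsum_scal. apply rsum_ext. intros; ring. Qed.

Lemma avg_const (N : nat) (c : R) : dyadic_mean N (fun _ => c) = c.
Proof.
  unfold dyadic_mean. rewrite rsum_const, pow_INR. change (INR 2) with 2. field. apply pow_nonzero. lra.
Qed.

Lemma avg_ge0 (N : nat) (g : R -> R) : (forall t, 0 <= g t) -> 0 <= dyadic_mean N g.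
Proof. intros H. rewrite <- (avg_const N 0). now apply avg_le. Qed.

Lemma avg_rsum (N m : nat) (g : nat -> R -> R) :
  dyadic_mean N (fun t => rsum m (fun i => g i t)) = rsum m (fun i => dyadic_mean N (g i)).
Proof.
  unfold dyadic_mean. rewrite rsum_swap. apply rsum_ext. intros j _. now rewrite rsum_scal.
Qed.

Lemma avg_Hoelder (N : nat) (a b : R -> R) (A B l : R) :
  0 < l < 1 -> 0 < A -> 0 < B -> (forall t, 0 <= a t) -> (forall t, 0 <= b t) ->
  dyadic_mean N a <= A -> dyadic_mean N b <= B ->
  dyadic_mean N (fun t => rpow (a t) l * rpow (b t) (1 - l)) <= rpow A l * rpow B (1 - l).
Proof.
  intros Hl HA HB Ha Hb Sa Sb.
  assert (Hc : 0 < / 2 ^ N) by (apply Rinv_0_lt_compat, pow_lt; lra).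
  eapply Rle_trans; [|apply (rsum_Hoelder (2 ^ N) (fun j => / 2 ^ N * a (INR j / 2 ^ N))
    (fun j => / 2 ^ N * b (INR j / 2 ^ N)) A B l Hl HA HB); auto;
    intros; apply Rmult_le_pos; auto; lra].
  right. apply rsum_ext. intros j _. rewrite !rpow_mul_base by (auto; lra).
  replace (/ 2 ^ N) with (rpow (/ 2 ^ N) l * rpow (/ 2 ^ N) (1 - l)) at 1; [ring|].
  rewrite <- rpow_plus. replace (l + (1 - l)) with 1 by ring. apply rpow_1. lra.
Qed.

Lemma avg_haar_sqr (N : nat) (I : Dyad) : (dlevel I <= N)%nat ->
  dyadic_mean N (fun t => haar I t ^ 2) = dlen I.
Proof.
  intros H. unfold dyadic_mean.
  assert (HN : 2 ^ N <> 0) by (apply pow_nonzero; lra).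
  (* [D] is the number of cells of level [N] in [I]; counting them gives the measure of [I]. *)
  set (D := (2 ^ (N - dlevel I))%nat).
  rewrite (rsum_ext _ _ (fun j => / 2 ^ N *
    (if andb (Nat.leb (dpos I * D) j) (Nat.ltb j ((dpos I + 1) * D)) then 1 else 0))).
  - rewrite rsum_scal, rsum_indicator.
    + replace ((dpos I + 1) * D - dpos I * D)%nat with D by nia.
      unfold D, dlen. rewrite pow_INR. change (INR 2) with 2.
      replace N with ((N - dlevel I) + dlevel I)%nat at 1 by lia.
      rewrite pow_add. field. split; apply pow_nonzero; lra.
    + split; [nia|]. replace (2 ^ N)%nat with (2 ^ dlevel I * D)%nat.
      * apply Nat.mul_le_mono_r. pose proof (proj2_sig I) as P. cbv beta in P.
        fold (dlevel I) (dpos I) in P. lia.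
      * unfold D. rewrite <- Nat.pow_add_r. f_equal. lia.
  - intros j _. f_equal.
    assert (Hj : INR j * / 2 ^ N <= INR j / 2 ^ N < (INR j + 1) * / 2 ^ N).
    { assert (0 < / 2 ^ N) by (apply Rinv_0_lt_compat, pow_lt; lra). unfold Rdiv. lra. }
    pose proof (dyadic_mem_nat (dlevel I) N (dpos I) j _ H Hj) as E.
    fold D in E. fold (dlen I) in E. fold (dmem I (INR j / 2 ^ N)) in E.
    destruct (Nat.leb_spec (dpos I * D) j); destruct (Nat.ltb_spec j ((dpos I + 1) * D));
      cbv [andb].
    1: destruct (haar_mem I (INR j / 2 ^ N)) as [-> | ->]; [apply E; split; assumption|ring|ring].
    all: rewrite haar_nmem; [ring|rewrite E; lia].
Qed.


(** * The square function localized to an interval *)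

Lemma sqfun_mk_ext (X : Banach) (I : nat -> Dyad) (x z : nat -> X) (m : nat) (t : R) :
  (forall i, (i < m)%nat -> x i = z i) -> sqfun (indexed_series I x m) t = sqfun (indexed_series I z m) t.
Proof.
  intros H. rewrite !sqfun_mk. f_equal. apply rad2_ext. intros i Hi. now rewrite H.
Qed.

(** Only the absolute values of the Haar factors count, since the random signs absorb the rest; the
    product of the two Haar values serves as multiplier. *)
Lemma sqfun_le_haar_sqr (X : Banach) (I : nat -> Dyad) (x : nat -> X) (m : nat) (t u : R) :
  (forall i, (i < m)%nat -> x i = bzero X \/ haar (I i) t ^ 2 = haar (I i) u ^ 2) ->
  sqfun (indexed_series I x m) t <= sqfun (indexed_series I x m) u.
Proof.
  intros H. rewrite !sqfun_mk. apply sqrt_le_1_alt, rad2_contraction.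
  intros i Hi. destruct (H i Hi) as [->|E].
  - exists 0. rewrite Rabs_R0, !bscal_0_r. split; [lra|reflexivity].
  - exists (haar (I i) t * haar (I i) u). rewrite bscal_assoc.
    destruct (Req_dec (haar (I i) u) 0) as [E0|E0].
    + rewrite E0 in *. assert (haar (I i) t = 0) as -> by nra.
      rewrite !Rmult_0_r, Rabs_R0. split; [lra|reflexivity].
    + apply haar_neq0_mem, haar_mem in E0. split.
      * apply Rabs_le. destruct E0 as [E0|E0]; rewrite E0 in *; nra.
      * f_equal. destruct E0 as [-> | ->]; ring.
Qed.

(* The square function over the intervals containing [I i], which is constant on [I i]:
   see [interval_sq_mem]. *)
Definition interval_sq {X : Banach} (I : nat -> Dyad) (x : nat -> X) (m i : nat) : R :=
  sqfun (indexed_series I (level_mask (fun l => dlevel (I l)) (dlevel (I i)) x) m) (dleft (I i)).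

(** Two points of [I i] lie in the same intervals of level at most that of [I i]; kept intervals
    that miss [I i] contribute nothing at either point. *)
Lemma interval_sq_mem (X : Banach) (I : nat -> Dyad) (x : nat -> X) (m i : nat) (t : R) :
  dmem (I i) t ->
  interval_sq I x m i = sqfun (indexed_series I (level_mask (fun l => dlevel (I l)) (dlevel (I i)) x) m) t.
Proof.
  intros Ht. unfold interval_sq. apply Rle_antisym; apply sqfun_le_haar_sqr; intros l _;
  unfold level_mask; destruct (Nat.leb_spec (dlevel (I l)) (dlevel (I i))); auto; right;
  [symmetry|]; now apply haar_sqr_const.
Qed.

Lemma interval_sq_ge0 (X : Banach) (I : nat -> Dyad) (x : nat -> X) (m i : nat) :
  0 <= interval_sq I x m i.
Proof. apply sqfun_ge0. Qed.

Lemma interval_sq_le (X : Banach) (I : nat -> Dyad) (x : nat -> X) (m i : nat) (t : R) :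
  dmem (I i) t -> interval_sq I x m i <= sqfun (indexed_series I x m) t.
Proof.
  intros Ht. rewrite (interval_sq_mem X I x m i t Ht), <- Rmult_1_l.
  apply sqfun_contraction; [lra|]. intros l _ _. unfold level_mask.
  destruct (Nat.leb_spec (dlevel (I l)) (dlevel (I i))).
  - exists 1. rewrite Rabs_R1, bscal_one. split; [lra|reflexivity].
  - exists 0. rewrite Rabs_R0, bscal_0_l. split; [lra|reflexivity].
Qed.

(** For an interval containing [t], [interval_sq] is the truncated square function at [t], so the
    weights are those of [rad2_weighted]; the other terms vanish. *)
Lemma sqfun_weighted (X : Banach) (I : nat -> Dyad) (x : nat -> X) (m : nat) (d k t : R) :
  0 < d -> 0 < k < 1 ->
  sqfun (indexed_series I (fun i => bscal X (rpow (d + interval_sq I x m i) (k - 1)) (x i)) m) t <=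
  / k * rpow (d + sqfun (indexed_series I x m) t) k.
Proof.
  intros Hd Hk.
  pose proof (rad2_weighted X m (fun i => dlevel (I i))
    (fun i => bscal X (haar (I i) t) (x i)) d k Hd Hk) as H.
  cbv zeta in H. rewrite <- sqfun_mk in H.
  eapply Rle_trans; [|exact H]. rewrite sqfun_mk. right. f_equal. apply rad2_ext.
  intros i Hi. rewrite !bscal_assoc.
  destruct (Req_dec (haar (I i) t) 0) as [E|E]; [now rewrite E, Rmult_0_l, Rmult_0_r|].
  apply haar_neq0_mem in E. rewrite (interval_sq_mem X I x m i t E), sqfun_mk.
  rewrite Rmult_comm. do 5 f_equal. apply rad2_ext. intros l Hl. unfold level_mask.
  destruct (Nat.leb (dlevel (I l)) (dlevel (I i))); [reflexivity|apply bscal_0_r].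
Qed.

(** * Hardy norms and the operator bound *)

Definition resolution (I : nat -> Dyad) (m : nat) : nat :=
  S (fold_right (fun i acc => Nat.max (dlevel (I i)) acc) O (seq 0 m)).

(** The mesh depends on [I] alone, so series with the same intervals and different coefficients are
    averaged over the same cells. *)
Lemma res_maxlev (X : Banach) (I : nat -> Dyad) (x : nat -> X) (m : nat) :
  S (maxlev (indexed_series I x m)) = resolution I m.
Proof.
  unfold maxlev, indexed_series, resolution. f_equal. induction (seq 0 m) as [|a l IH]; simpl; [reflexivity|].
  now rewrite IH.
Qed.

Lemma dlevel_le_res (I : nat -> Dyad) (m i : nat) : (i < m)%nat -> (dlevel (I i) <= resolution I m)%nat.
Proof.
  intros Hi. unfold resolution.
  assert (H : List.In i (seq 0 m)) by (apply in_seq; lia). revert H.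
  induction (seq 0 m) as [|a l IH]; simpl; [tauto|]. intros [->|H]; [lia|].
  specialize (IH H). lia.
Qed.

Definition Hpow {X : Banach} (p : R) (I : nat -> Dyad) (x : nat -> X) (m : nat) : R :=
  dyadic_mean (resolution I m) (fun t => rpow (sqfun (indexed_series I x m) t) p).

Lemma Hnorm_mk (X : Banach) (p : R) (I : nat -> Dyad) (x : nat -> X) (m : nat) :
  Hnorm p (indexed_series I x m) = rpow (Hpow p I x m) (/ p).
Proof. unfold Hnorm. rewrite res_maxlev. reflexivity. Qed.

Lemma Hpow_ge0 (X : Banach) (p : R) (I : nat -> Dyad) (x : nat -> X) (m : nat) : 0 <= Hpow p I x m.
Proof. apply avg_ge0. intros; apply rpow_ge0. Qed.

Lemma Trearr_mk (X : Banach) (tau : Dyad -> Dyad) (p : R) (I : nat -> Dyad) (x : nat -> X) m :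
  Trearr tau p (indexed_series I x m) =
  indexed_series (fun i => tau (I i))
     (fun i => bscal X (rpow (dlen (I i) / dlen (tau (I i))) (/ p)) (x i)) m.
Proof. unfold Trearr, indexed_series. now rewrite map_map. Qed.

(** Homogeneity: [opnorm_le] tests only the unit ball, so the series is scaled by [Y^(-1/p)]. A
    positive bound [Y] avoids dividing by a vanishing norm. *)
Lemma opnorm_Hpow (X : Banach) (tau : Dyad -> Dyad) (p M : R) (I : nat -> Dyad) (x : nat -> X)
  (m : nat) (Y : R) :
  0 < p -> opnorm_le X tau p M -> NoDup (map I (seq 0 m)) -> 0 < Y -> Hpow p I x m <= Y ->
  Hpow p (fun i => tau (I i))
     (fun i => bscal X (rpow (dlen (I i) / dlen (tau (I i))) (/ p)) (x i)) m <= rpow M p * Y.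
Proof.
  intros Hp0 HM Hv HY H.
  set (c := rpow Y (- / p)).
  assert (Hc : 0 <= c) by apply rpow_ge0.
  assert (Ec : rpow c p * Y = 1).
  { unfold c. rewrite rpow_rpow. replace (- / p * p) with (- (1)) by (field; lra).
    rewrite Rmult_comm. rewrite <- (rpow_1 Y) at 1 by lra. now apply rpow_opp. }
  assert (Hscal : forall K z, Hpow p K (fun i => bscal X c (z i)) m = rpow c p * Hpow p K z m).
  { intros K z. unfold Hpow. rewrite <- avg_scal. apply avg_ext. intros t.
    rewrite sqfun_scal by exact Hc. apply rpow_mul_base; [exact Hc|apply sqfun_ge0]. }
  specialize (HM (indexed_series I (fun i => bscal X c (x i)) m)).
  rewrite Trearr_mk, !Hnorm_mk, Hscal in HM.
  assert (Hip : 0 < / p) by now apply Rinv_0_lt_compat.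
  set (K := fun i => tau (I i)) in *.
  set (z := fun i => bscal X (rpow (dlen (I i) / dlen (tau (I i))) (/ p)) (x i)) in *.
  replace (Hpow p K _ m) with (rpow c p * Hpow p K z m) in HM.
  2:{ rewrite <- Hscal. unfold Hpow. apply avg_ext. intros t. f_equal. apply sqfun_mk_ext.
      intros i _. unfold z. rewrite !bscal_assoc. f_equal. ring. }
  assert (HM' : rpow (rpow c p * Hpow p K z m) (/ p) <= M).
  { apply HM.
    - unfold valid_series, indexed_series. now rewrite map_map.
    - rewrite <- (rpow_1_l (/ p)). apply rpow_le; [lra|]. split.
      + apply Rmult_le_pos; [apply rpow_ge0|apply Hpow_ge0].
      + rewrite <- Ec. apply Rmult_le_compat_l; [apply rpow_ge0|exact H]. }
  apply (conj (rpow_ge0 _ _)), (rpow_le _ _ p (Rlt_le _ _ Hp0)) in HM'.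
  rewrite rpow_rpow, Rinv_l, rpow_1 in HM'
    by (try lra; (apply Rmult_le_pos; [apply rpow_ge0|apply Hpow_ge0])).
  apply (Rmult_le_compat_r Y) in HM'; [|lra].
  replace (rpow c p * Hpow p K z m * Y) with (rpow c p * Y * Hpow p K z m) in HM' by ring.
  rewrite Ec in HM'. lra.
Qed.

Lemma unit_vector (X : Banach) : nonzero_space X -> exists e : X, bnorm X e = 1.
Proof.
  intros [x Hx]. assert (H : bnorm X x <> 0) by (intros E; now apply Hx, bnorm_zero).
  pose proof (bnorm_ge0 X x). exists (bscal X (/ bnorm X x) x).
  rewrite bnorm_scal, Rabs_inv, Rabs_pos_eq by lra. field. exact H.
Qed.

(** The Haar function of [[0,1)] times a unit vector has norm 1, and so has its image, because the
    factor in [Trearr] compensates the length of the image interval. *)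
Lemma opnorm_gt0 (X : Banach) (tau : Dyad -> Dyad) (p M : R) :
  nonzero_space X -> 0 < p -> opnorm_le X tau p M -> 0 < M.
Proof.
  intros HX Hp0 HM. destruct (unit_vector X HX) as [e He].
  set (O0 := exist (fun nk : nat * nat => (snd nk < 2 ^ fst nk)%nat) (O, O) Nat.lt_0_1 : Dyad).
  assert (Hone : forall K a, 0 <= a -> Hpow p (fun _ => K) (fun _ => bscal X a e) 1 = rpow a p * dlen K).
  { intros K a Ha. unfold Hpow. rewrite <- (avg_haar_sqr (resolution (fun _ => K) 1) K)
      by (apply (dlevel_le_res (fun _ => K) 1 O); lia).
    rewrite <- avg_scal. apply avg_ext. intros t.
    rewrite (sqfun_scal X (fun _ => K) (fun _ => e)) by exact Ha.
    rewrite rpow_mul_base by (try apply sqfun_ge0; exact Ha). f_equal.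
    rewrite <- (Rmult_1_l (haar K t ^ 2)).
    assert (E : sqfun (indexed_series (fun _ => K) (fun _ => e) 1) t ^ 2 = haar K t ^ 2).
    { rewrite (sqfun_mk_ext X _ _ (fun _ => bscal X 1 e)) by (intros; now rewrite bscal_one).
      rewrite (sqfun_scalar X e (fun _ => K) (fun _ => 1)) by exact He. simpl. ring. }
    pose proof (sqfun_ge0 X (indexed_series (fun _ => K) (fun _ => e) 1) t) as Hs.
    destruct (Req_dec (haar K t) 0) as [E0|E0].
    - rewrite E0 in *. replace (sqfun _ t) with 0 by nra. rewrite rpow_0. ring.
    - apply haar_neq0_mem, haar_mem in E0.
      assert (E1 : haar K t ^ 2 = 1) by (destruct E0 as [-> | ->]; ring). rewrite E1 in *.
      replace (sqfun _ t) with 1 by nra. rewrite rpow_1_l. ring. }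
  pose proof (opnorm_Hpow X tau p M (fun _ => O0) (fun _ => bscal X 1 e) 1 1 Hp0 HM) as H.
  rewrite Hone, rpow_1_l in H by lra.
  assert (E : dlen O0 = 1) by (unfold dlen, dlevel; simpl; field).
  rewrite E in H. specialize (H ltac:(repeat constructor; simpl; tauto) ltac:(lra) ltac:(lra)).
  set (a := rpow (1 / dlen (tau O0)) (/ p)) in H.
  replace (Hpow p _ _ 1) with (rpow a p * dlen (tau O0)) in H.
  2:{ rewrite <- Hone by apply rpow_ge0. unfold Hpow. apply avg_ext. intros t. f_equal.
      apply sqfun_mk_ext. intros. now rewrite bscal_one. }
  unfold a in H. pose proof (dlen_gt0 (tau O0)) as Hd.
  rewrite rpow_rpow, Rinv_l, rpow_1 in H
    by (try lra; unfold Rdiv; rewrite Rmult_1_l; left; now apply Rinv_0_lt_compat).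
  (* For [M <= 0] the convention gives [rpow M p = 0], against a left side equal to 1. *)
  apply Rnot_le_lt. intros HM0. unfold rpow in H. destruct (Rle_dec M 0); [|lra].
  unfold Rdiv in H. rewrite Rmult_1_l, Rinv_l in H; lra.
Qed.

(** * Rearranged maximal functions *)

Lemma argmax_weights (m : nat) (v : nat -> R) : (forall i, 0 <= v i) ->
  {e : nat -> R | (forall i, 0 <= e i) /\ rsum m e <= 1 /\
     forall i, (i < m)%nat -> v i <= rsum m (fun k => e k * v k)}.
Proof.
  (* The weights are a point mass at an index of maximal value, or zero if no value is positive.
     They are built informatively, so that they can later be taken as functions of [t]. *)
  intros Hv. induction m as [|m [e [H0 [H1 H2]]]].
  - exists (fun _ => 0). repeat split; intros; simpl; try lra; lia.
  - set (V := rsum m (fun k => e k * v k)).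
    destruct (Rle_dec (v m) V) as [H|H].
    + exists (fun k => if Nat.eqb k m then 0 else e k).
      assert (E : forall g, rsum m (fun k => (if Nat.eqb k m then 0 else e k) * g k) =
                    rsum m (fun k => e k * g k)).
      { intros g. apply rsum_ext. intros i Hi. destruct (Nat.eqb_spec i m); [lia|reflexivity]. }
      simpl rsum. rewrite Nat.eqb_refl, E. fold V. repeat split.
      * intros i. destruct (Nat.eqb i m); [lra|apply H0].
      * rewrite (rsum_ext _ _ e); [lra|]. intros i Hi.
        destruct (Nat.eqb_spec i m); [lia|reflexivity].
      * intros i Hi. destruct (Nat.eq_dec i m) as [->|]; [lra|].
        specialize (H2 i ltac:(lia)). fold V in H2. lra.
    + exists (fun k => if Nat.eqb k m then 1 else 0).
      assert (E : forall g, rsum m (fun k => (if Nat.eqb k m then 1 else 0) * g k) = 0).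
      { intros g. rewrite (rsum_ext _ _ (fun _ => 0)); [rewrite rsum_const; lra|].
        intros i Hi. destruct (Nat.eqb_spec i m); [lia|lra]. }
      simpl rsum. rewrite Nat.eqb_refl, E. repeat split.
      * intros i. destruct (Nat.eqb i m); lra.
      * rewrite (rsum_ext _ _ (fun _ => 0)); [rewrite rsum_const; lra|].
        intros i Hi. destruct (Nat.eqb_spec i m); [lia|lra].
      * intros i Hi. destruct (Nat.eq_dec i m) as [->|]; [lra|].
        specialize (H2 i ltac:(lia)). fold V in H2. lra.
Qed.


(** [(2/p)^p] stems from Abel summation with [k = p/2], and [2^p * 2] from the mean of
    [(del + D)^p]. *)
Definition emb_const (p : R) : R := rpow (2 / p) p * (rpow 2 p * 2).

Lemma rpow_sqr (x p : R) : 0 <= x -> rpow (x ^ 2) (p / 2) = rpow x p.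
Proof. intros H. rewrite <- rpow_2, rpow_rpow by exact H. f_equal. field. Qed.

(** The sum [N] on the left is bounded by a smaller power of itself: it controls the test series,
    hence through [M] the image series, from which [N] is recovered; division by [N^(p/2)] closes
    the estimate. *)
Lemma linearized_embedding (X : Banach) (e0 : X) (tau : Dyad -> Dyad) (p M B : R)
  (I : nat -> Dyad) (m : nat) (u : nat -> R) (W : R -> R) (e : nat -> R -> R) :
  let J := fun i => tau (I i) in
  bnorm X e0 = 1 -> 0 < p < 2 -> 0 < M -> 0 < B -> opnorm_le X tau p M ->
  NoDup (map I (seq 0 m)) ->
  (forall i, 0 < u i) -> (forall t, 0 <= W t) ->
  (forall i t, dmem (I i) t -> u i <= W t) -> dyadic_mean (resolution I m) W <= B ->
  (forall i t, 0 <= e i t) -> (forall i t, e i t <> 0 -> dmem (J i) t) ->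
  (forall t, rsum m (fun i => e i t) <= 1) ->
  rsum m (fun i => u i * (dlen (I i) / dlen (J i)) * dyadic_mean (resolution J m) (e i)) <=
  rpow (emb_const p) (2 / (2 - p)) * rpow M (2 * p / (2 - p)) * B.
Proof.
  intros J He0 Hp HM HB Hop Hnd Hu HW HuW HWB He HeJ He1.
  set (N := rsum m _).
  (* The division by a power of [N] at the end needs [0 < N]. *)
  destruct (Rle_dec N 0) as [HN|HN].
  { apply Rle_trans with (1 := HN).
    apply Rmult_le_pos; [apply Rmult_le_pos; apply rpow_ge0|lra]. }
  apply Rnot_le_lt in HN.
  assert (HdI : forall i, 0 < dlen (I i)) by (intros; apply dlen_gt0).
  assert (HdJ : forall i, 0 < dlen (J i)) by (intros; apply dlen_gt0).
  assert (Hratio : forall i, 0 < dlen (I i) / dlen (J i))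
    by (intros; unfold Rdiv; apply Rmult_lt_0_compat; [|apply Rinv_0_lt_compat]; auto).
  (* [c i] is the fraction of [J i] selected by the weights, so that [N] is the integral of the sum
     of [u_i c_i h_(I i)^2]. *)
  set (c := fun i => dyadic_mean (resolution J m) (e i) / dlen (J i)).
  assert (Hc : forall i, 0 <= c i).
  { intros i. apply Rmult_le_pos; [now apply avg_ge0|].
    left. now apply Rinv_0_lt_compat. }
  (* These exponents give [y_i^2 = u_i^(2/p-1) (u_i c_i)]. On [I i] the first factor is at most
     [W^(2/p-1)], and Hoelder with exponents [p/2] and [1-p/2] yields [Y]. *)
  set (y := fun i => rpow (u i) (/ p) * rpow (c i) (/ 2)).
  assert (Hy : forall i, 0 <= y i) by (intros; apply Rmult_le_pos; apply rpow_ge0).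
  assert (Hg : forall i t, 0 <= u i * c i * haar (I i) t ^ 2).
  { intros i t. apply Rmult_le_pos; [|apply pow2_ge_0].
    apply Rmult_le_pos; [left|]; auto. }
  set (Y := rpow N (p / 2) * rpow B (1 - p / 2)).
  assert (HY : 0 < Y) by (apply Rmult_lt_0_compat; now apply rpow_gt0).
  assert (HN_eq : N = rsum m (fun i => u i * c i * dlen (I i))).
  { apply rsum_ext. intros i _. unfold c. field. specialize (HdJ i). lra. }
  assert (Hf : Hpow p I (fun i => bscal X (y i) e0) m <= Y).
  { unfold Hpow.
    apply Rle_trans with (dyadic_mean (resolution I m) (fun t =>
      rpow (rsum m (fun i => u i * c i * haar (I i) t ^ 2)) (p / 2) * rpow (W t) (1 - p / 2))).
    - apply avg_le. intros t.
      rewrite <- rpow_sqr by apply sqfun_ge0. rewrite sqfun_scalar by exact He0.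
      replace (rpow (W t) (1 - p / 2)) with (rpow (rpow (W t) (2 / p - 1)) (p / 2))
        by (rewrite rpow_rpow; f_equal; field; lra).
      rewrite <- rpow_mul_base.
      2: apply rsum_nonneg; auto.
      2: apply rpow_ge0.
      apply rpow_le; [lra|]. split.
      { apply rsum_nonneg. intros i _. apply Rmult_le_pos; apply pow2_ge_0. }
      rewrite Rmult_comm, <- rsum_scal. apply rsum_le. intros i _.
      destruct (Req_dec (haar (I i) t) 0) as [E|E]; [rewrite E; lra|].
      apply haar_neq0_mem, HuW in E.
      assert (Ey : y i ^ 2 = rpow (u i) (2 / p - 1) * (u i * c i)).
      { rewrite <- rpow_2 by apply Hy. unfold y.
        rewrite rpow_mul_base, !rpow_rpow by apply rpow_ge0.
        replace (/ 2 * 2) with 1 by field. rewrite rpow_1 by apply Hc.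
        replace (/ p * 2) with (2 / p - 1 + 1) by (field; lra).
        rewrite rpow_plus, rpow_1 by (left; apply Hu). ring. }
      rewrite Ey, (Rmult_assoc (rpow _ _) _ (_ ^ 2)). apply Rmult_le_compat_r.
      + apply Hg.
      + specialize (Hu i). apply rpow_le; [|lra].
        apply Rmult_le_reg_r with p; [lra|].
        replace ((2 / p - 1) * p) with (2 - p) by (field; lra). lra.
    - apply avg_Hoelder; auto; try lra.
      + intros t. apply rsum_nonneg. intros i _.
        auto.
      + rewrite avg_rsum, HN_eq. apply rsum_le. intros i Hi.
        rewrite avg_scal, avg_haar_sqr by now apply dlevel_le_res. lra. }
  set (d := fun i => rpow (dlen (I i) / dlen (J i)) (/ p) * y i).
  assert (Hd : forall i, 0 <= d i) by (intros; apply Rmult_le_pos; [apply rpow_ge0|auto]).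
  assert (HD : Hpow p J (fun i => bscal X (d i) e0) m <= rpow M p * Y).
  { pose proof (opnorm_Hpow X tau p M I _ m Y ltac:(lra) Hop Hnd HY Hf) as H.
    eapply Rle_trans; [|exact H]. right. unfold Hpow. apply avg_ext. intros t. f_equal.
    apply sqfun_mk_ext. intros i _. now rewrite bscal_assoc. }
  set (D := fun t => sqfun (indexed_series J (fun i => bscal X (d i) e0) m) t).
  assert (HD0 : forall t, 0 <= D t) by (intros; apply sqfun_ge0).
  assert (HMY : 0 < rpow M p * Y) by (apply Rmult_lt_0_compat; [now apply rpow_gt0|exact HY]).
  (* The shift has the size of the bound on the image norm, so adding it to [D] costs only a
     constant. *)
  set (del := rpow (rpow M p * Y) (/ p)).
  assert (Hdel : 0 < del) by now apply rpow_gt0.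
  set (Q := rpow 2 p * 2 * (rpow M p * Y)).
  assert (HQ0 : 0 < Q) by (repeat apply Rmult_lt_0_compat; auto; try lra; apply rpow_gt0; lra).
  assert (HQ : dyadic_mean (resolution J m) (fun t => rpow (del + D t) p) <= Q).
  { apply Rle_trans with (dyadic_mean (resolution J m) (fun t => rpow 2 p * (rpow del p + rpow (D t) p))).
    - apply avg_le. intros t. apply rpow_plus_le; auto; lra.
    - rewrite avg_scal, avg_plus, avg_const. unfold Q.
      rewrite Rmult_assoc. apply Rmult_le_compat_l; [apply rpow_ge0|].
      unfold del at 1. rewrite rpow_rpow, Rinv_l, rpow_1 by lra.
      unfold Hpow in HD. fold D in HD. unfold D at 1. lra. }
  set (s := fun i => interval_sq J (fun i => bscal X (d i) e0) m i).
  assert (Hs : forall i, 0 < del + s i)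
    by (intros i; pose proof (interval_sq_ge0 X J (fun i => bscal X (d i) e0) m i);
        unfold s; lra).
  set (w := fun i => rpow (del + s i) (p / 2 - 1)).
  (* Hoelder over the index: one factor is the squared [H^2] norm of the image weighted by [w], the
     other the linearized maximal function of [(del + s)^p]. *)
  assert (HN2 : N <= rpow ((2 / p) ^ 2 * Q) (p / 2) * rpow Q (1 - p / 2)).
  { rewrite HN_eq.
    apply Rle_trans with (rsum m (fun i => rpow ((w i * d i) ^ 2 * dlen (J i)) (p / 2) *
      rpow (rpow (del + s i) p * dyadic_mean (resolution J m) (e i)) (1 - p / 2))).
    (* The powers of [del + s_i] cancel, those of [c_i] and of the length of [J i] combine to
       exponent 1, and [d_i^p] supplies [u_i] and the ratio of lengths. *)
    - right. apply rsum_ext. intros i _.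
      replace (dyadic_mean (resolution J m) (e i)) with (c i * dlen (J i))
        by (unfold c; field; specialize (HdJ i); lra).
      assert (Hw : 0 <= w i) by apply rpow_ge0.
      assert (HJ' := HdJ i). assert (Hdi := Hd i). assert (Hci := Hc i).
      rewrite rpow_mul_base; [|apply pow2_ge_0|lra].
      rewrite rpow_sqr by now apply Rmult_le_pos.
      rewrite !rpow_mul_base; auto; try lra;
        try (apply Rmult_le_pos; lra); try apply rpow_ge0.
      unfold w, d, y. rewrite !rpow_mul_base; try (apply Rmult_le_pos); try apply rpow_ge0.
      rewrite !rpow_rpow.
      assert (E1 : rpow (del + s i) ((p / 2 - 1) * p) * rpow (del + s i) (p * (1 - p / 2)) = 1).
      { replace (p * (1 - p / 2)) with (- ((p / 2 - 1) * p)) by ring. now apply rpow_opp. }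
      assert (E2 : rpow (dlen (J i)) (p / 2) * rpow (dlen (J i)) (1 - p / 2) = dlen (J i)).
      { rewrite <- rpow_plus. replace (p / 2 + (1 - p / 2)) with 1 by ring. now apply rpow_1, Rlt_le. }
      assert (E3 : rpow (c i) (/ 2 * p) * rpow (c i) (1 - p / 2) = c i).
      { rewrite <- rpow_plus. replace (/ 2 * p + (1 - p / 2)) with 1 by field. now apply rpow_1. }
      replace (/ p * p) with 1 by (field; lra).
      rewrite (rpow_1 (u i)) by (left; auto). rewrite (rpow_1 (_ / _)) by (left; auto).
      transitivity
        ((rpow (del + s i) ((p / 2 - 1) * p) * rpow (del + s i) (p * (1 - p / 2))) *
         (dlen (I i) / dlen (J i) *
            (rpow (dlen (J i)) (p / 2) * rpow (dlen (J i)) (1 - p / 2))) *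
         u i * (rpow (c i) (/ 2 * p) * rpow (c i) (1 - p / 2)));
        [rewrite E1, E2, E3; field; lra|ring].
    - apply rsum_Hoelder; try lra.
      + apply Rmult_lt_0_compat; [|exact HQ0]. apply pow_lt.
        apply Rmult_lt_0_compat; [lra|apply Rinv_0_lt_compat; lra].
      + intros i _. apply Rmult_le_pos; [apply pow2_ge_0|left; auto].
      + intros i _. apply Rmult_le_pos; [apply rpow_ge0|now apply avg_ge0].
      + apply Rle_trans with (dyadic_mean (resolution J m) (fun t => (2 / p) ^ 2 * rpow (del + D t) p)).
        * apply Rle_trans with (dyadic_mean (resolution J m) (fun t =>
            rsum m (fun i => (w i * d i) ^ 2 * haar (J i) t ^ 2))).
          -- rewrite avg_rsum. apply rsum_le. intros i Hi.
             rewrite avg_scal, avg_haar_sqr by now apply dlevel_le_res. lra.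
          -- apply avg_le. intros t.
             rewrite <- (sqfun_scalar X e0 J (fun i => w i * d i)) by exact He0.
             pose proof (sqfun_weighted X J (fun i => bscal X (d i) e0) m del (p / 2) t
               Hdel ltac:(lra)) as H.
             fold (D t) in H.
             rewrite (sqfun_mk_ext X J _ (fun i => bscal X (w i * d i) e0)) in H
               by (intros; apply bscal_assoc).
             replace ((2 / p) ^ 2 * rpow (del + D t) p)
               with ((/ (p / 2) * rpow (del + D t) (p / 2)) ^ 2).
             ++ apply pow_incr. split; [apply sqfun_ge0|exact H].
             ++ rewrite Rpow_mult_distr. f_equal; [f_equal; field; lra|].
                rewrite <- rpow_2, rpow_rpow by apply rpow_ge0. f_equal. field.
        * rewrite avg_scal. apply Rmult_le_compat_l; [apply pow2_ge_0|exact HQ].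
      + apply Rle_trans with (2 := HQ).
        rewrite (rsum_ext _ _ (fun i => dyadic_mean (resolution J m) (fun t => rpow (del + s i) p * e i t)))
          by (intros; now rewrite avg_scal).
        rewrite <- avg_rsum. apply avg_le. intros t.
        apply Rle_trans with (rsum m (fun i => rpow (del + D t) p * e i t)).
        * apply rsum_le. intros i _.
          (* A nonzero weight places [t] in [J i], where [s i] is at most the full square
             function. *)
          destruct (Req_dec (e i t) 0) as [E|E]; [rewrite E; lra|].
          apply Rmult_le_compat_r; [apply He|]. apply rpow_le; [lra|].
          specialize (Hs i). split; [lra|].
          pose proof (interval_sq_le X J (fun i => bscal X (d i) e0) m i t (HeJ i t E)) as H.
          fold (D t) in H. unfold s. lra.
        * rewrite rsum_scal. rewrite <- (Rmult_1_r (rpow (del + D t) p)) at 2.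
          apply Rmult_le_compat_l; [apply rpow_ge0|apply He1]. }
  assert (HN3 : rpow N (1 - p / 2) <= emb_const p * rpow M p * rpow B (1 - p / 2)).
  { apply Rmult_le_reg_l with (rpow N (p / 2)); [now apply rpow_gt0|].
    rewrite <- rpow_plus. replace (p / 2 + (1 - p / 2)) with 1 by ring.
    rewrite rpow_1 by lra. apply Rle_trans with (1 := HN2). right.
    assert (0 < 2 / p) by (apply Rmult_lt_0_compat; [lra|apply Rinv_0_lt_compat; lra]).
    rewrite rpow_mul_base by (try apply pow2_ge_0; lra). rewrite rpow_sqr by lra.
    rewrite Rmult_assoc, <- rpow_plus. replace (p / 2 + (1 - p / 2)) with 1 by ring.
    rewrite rpow_1 by lra. unfold emb_const, Q, Y. ring. }
  (* [2/(2-p)] is the reciprocal of [1-p/2], which isolates [N]. *)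
  apply (conj (rpow_ge0 _ _)), (rpow_le _ _ (2 / (2 - p))) in HN3.
  2:{ apply Rmult_le_pos; [lra|left; apply Rinv_0_lt_compat; lra]. }
  assert (HC : 0 <= emb_const p)
    by (repeat apply Rmult_le_pos; try apply rpow_ge0; lra).
  rewrite rpow_mul_base in HN3
    by (try apply Rmult_le_pos; try apply rpow_ge0; exact HC).
  rewrite rpow_mul_base, !rpow_rpow in HN3 by (try apply rpow_ge0; exact HC).
  replace ((1 - p / 2) * (2 / (2 - p))) with 1 in HN3 by (field; lra).
  rewrite !rpow_1 in HN3 by lra.
  replace (p * (2 / (2 - p))) with (2 * p / (2 - p)) in HN3 by (field; lra). exact HN3.
Qed.

(** At each [t] the weights of [argmax_weights] realize the supremum; the sum against them is [V],
    and its integral is the quantity in [linearized_embedding]. *)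
Lemma maximal_rearrangement (X : Banach) (tau : Dyad -> Dyad) (p M B : R)
  (I : nat -> Dyad) (m : nat) (u : nat -> R) (W : R -> R) :
  let J := fun i => tau (I i) in
  nonzero_space X -> 0 < p < 2 -> 0 < B -> opnorm_le X tau p M ->
  NoDup (map I (seq 0 m)) ->
  (forall i, 0 < u i) -> (forall t, 0 <= W t) ->
  (forall i t, dmem (I i) t -> u i <= W t) -> dyadic_mean (resolution I m) W <= B ->
  exists V : R -> R, (forall t, 0 <= V t) /\
    (forall i t, (i < m)%nat -> dmem (J i) t -> u i * (dlen (I i) / dlen (J i)) <= V t) /\
    dyadic_mean (resolution J m) V <= rpow (emb_const p) (2 / (2 - p)) * rpow M (2 * p / (2 - p)) * B.
Proof.
  intros J HX Hp HB Hop Hnd Hu HW HuW HWB.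
  destruct (unit_vector X HX) as [e0 He0].
  set (a := fun i => u i * (dlen (I i) / dlen (J i))).
  assert (Ha : forall i, 0 <= a i).
  { intros i. left. apply Rmult_lt_0_compat; [apply Hu|].
    apply Rmult_lt_0_compat; [|apply Rinv_0_lt_compat]; apply dlen_gt0. }
  assert (Hv : forall t i, 0 <= a i * haar (J i) t ^ 2)
    by (intros; apply Rmult_le_pos; [apply Ha|apply pow2_ge_0]).
  set (w := fun t => argmax_weights m (fun i => a i * haar (J i) t ^ 2) (Hv t)).
  (* The squared Haar factor confines the weights to [J i]. *)
  set (e := fun i t => proj1_sig (w t) i * haar (J i) t ^ 2).
  assert (He : forall i t, 0 <= e i t).
  { intros i t. unfold e. destruct (w t) as [g [Hg Hg1]]. simpl proj1_sig.
    apply Rmult_le_pos; [apply Hg|apply pow2_ge_0]. }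
  exists (fun t => rsum m (fun i => a i * e i t)). repeat split.
  - intros t. apply rsum_nonneg. intros i _. apply Rmult_le_pos; auto.
  - intros i t Hi Ht. unfold e. destruct (w t) as [g [Hg0 [Hg1 Hg]]]. simpl proj1_sig.
    specialize (Hg i Hi). apply haar_mem in Ht. fold (a i).
    replace (haar (J i) t ^ 2) with 1 in Hg by (destruct Ht as [-> | ->]; ring).
    rewrite Rmult_1_r in Hg. apply Rle_trans with (1 := Hg). right.
    apply rsum_ext. intros; ring.
  - rewrite avg_rsum, (rsum_ext _ _ (fun i => a i * dyadic_mean (resolution J m) (e i)))
      by (intros; apply avg_scal).
    apply (linearized_embedding X e0 tau p M B I m u W e); auto.
    + now apply (opnorm_gt0 X tau p M).
    + intros i t H. apply haar_neq0_mem. intros E. apply H. unfold e. fold (J i) in E.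
      rewrite E. ring.
    + intros t. unfold e. destruct (w t) as [g [Hg [Hg1 Hg2]]]. simpl proj1_sig.
      apply Rle_trans with (2 := Hg1). apply rsum_le. intros i _. specialize (Hg i).
      destruct (Req_dec (haar (J i) t) 0) as [E|E]; [rewrite E; lra|].
      apply haar_neq0_mem, haar_mem in E. destruct E as [-> | ->]; lra.
Qed.


(** * Comparison of the operator norms for [q] and [p] *)

Theorem theorem2 :
  forall p q : R, 0 < q -> q <= p -> p < 2 ->
  exists A : R, 0 < A /\
    forall (X : Banach), nonzero_space X ->
    forall tau : Dyad -> Dyad, (forall I J, tau I = tau J -> I = J) ->
    forall M : R, opnorm_le X tau p M ->
    forall f : haar_series X, valid_series f -> Hnorm q f <= 1 ->
      rpow (Hnorm q (Trearr tau q f)) (q / (2 - q)) <= A * rpow M (p / (2 - p)).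
Proof.
  intros p q Hq Hqp Hp.
  (* Hoelder with exponent [q/p] needs [q < p]; for [q = p] both sides carry the same power and the
     constant is 1. *)
  destruct Hqp as [Hqp| ->].
  2:{ exists 1. split; [lra|]. intros X _ tau _ M HM f Hf Hf1. rewrite Rmult_1_l.
      apply rpow_le; [|split; [apply rpow_ge0|now apply HM]].
      apply Rmult_le_pos; [lra|left; apply Rinv_0_lt_compat; lra]. }
  (* [Ec] bounds the mean of [(1 + S(f))^q] on the unit ball, [C1] that of [S(g)^p], and [C2] is the
     factor free of [M] in the maximal estimate. *)
  set (Ec := rpow 2 q * 2).
  assert (HEc : 0 < Ec) by (apply Rmult_lt_0_compat; [apply rpow_gt0|]; lra).
  set (C1 := rpow (/ (q / p)) p * Ec).
  assert (Hqp1 : 0 < q / p < 1).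
  { split; [apply Rmult_lt_0_compat; [lra|apply Rinv_0_lt_compat; lra]|].
    apply Rmult_lt_reg_r with p; [lra|]. unfold Rdiv. rewrite Rmult_assoc, Rinv_l; lra. }
  assert (HC1 : 0 < C1).
  { apply Rmult_lt_0_compat; [|exact HEc]. apply rpow_gt0, Rinv_0_lt_compat. lra. }
  set (C2 := rpow (emb_const p) (2 / (2 - p)) * Ec).
  assert (HC2 : 0 < C2).
  { apply Rmult_lt_0_compat; [|exact HEc]. apply rpow_gt0. unfold emb_const.
    repeat apply Rmult_lt_0_compat; try lra; apply rpow_gt0; try lra.
    apply Rmult_lt_0_compat; [lra|apply Rinv_0_lt_compat; lra]. }
  assert (Hq2 : 0 < / (2 - q)) by (apply Rinv_0_lt_compat; lra).
  exists (rpow (rpow C1 (q / p) * rpow C2 (1 - q / p)) (/ (2 - q))). split.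
  { apply rpow_gt0, Rmult_lt_0_compat; now apply rpow_gt0. }
  intros X HX tau _ M HM f Hval Hf.
  assert (HM0 : 0 < M) by (apply (opnorm_gt0 X tau p M); auto; lra).
  set (O0 := exist (fun nk : nat * nat => (snd nk < 2 ^ fst nk)%nat) (O, O) Nat.lt_0_1 : Dyad).
  rewrite (mk_nth X (O0, bzero X) f) in Hf, Hval |- *.
  revert Hf Hval.
  generalize (fun i => fst (nth i f (O0, bzero X))) as I.
  generalize (fun i => snd (nth i f (O0, bzero X))) as x.
  generalize (length f) as m. intros m x I Hf Hval. clear f O0.
  unfold valid_series, indexed_series in Hval. rewrite map_map in Hval. cbn [fst] in Hval.
  rewrite Trearr_mk, Hnorm_mk. rewrite Hnorm_mk in Hf.
  set (J := fun i => tau (I i)).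
  set (r := fun i => dlen (I i) / dlen (J i)).
  assert (Hr : forall i, 0 < r i)
    by (intros i; apply Rmult_lt_0_compat; [|apply Rinv_0_lt_compat]; apply dlen_gt0).
  assert (Hf' : Hpow q I x m <= 1).
  { apply (conj (rpow_ge0 _ _)), (rpow_le _ _ q (Rlt_le _ _ Hq)) in Hf.
    rewrite rpow_rpow, Rinv_l, rpow_1, rpow_1_l in Hf; try lra. apply Hpow_ge0. }
  (* The shift [delta] is taken to be 1, the bound on the norm of [f]. *)
  set (s := fun i => interval_sq I x m i).
  assert (Hs : forall i, 0 < 1 + s i)
    by (intros i; pose proof (interval_sq_ge0 X I x m i); unfold s; lra).
  set (W := fun t => rpow (1 + sqfun (indexed_series I x m) t) q).
  assert (HW : dyadic_mean (resolution I m) W <= Ec).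
  { apply Rle_trans with (dyadic_mean (resolution I m) (fun t =>
      rpow 2 q * (rpow 1 q + rpow (sqfun (indexed_series I x m) t) q))).
    - apply avg_le. intros t. apply rpow_plus_le; [lra|lra|apply sqfun_ge0].
    - rewrite avg_scal, avg_plus, avg_const, rpow_1_l. apply Rmult_le_compat_l; [apply rpow_ge0|].
      unfold Hpow in Hf'. lra. }
  set (g := fun i => bscal X (rpow (1 + s i) (q / p - 1)) (x i)).
  assert (Hg : Hpow p I g m <= C1).
  { apply Rle_trans with (dyadic_mean (resolution I m) (fun t => rpow (/ (q / p)) p * W t)).
    - apply avg_le. intros t.
      pose proof (sqfun_weighted X I x m 1 (q / p) t ltac:(lra) Hqp1) as H.
      apply (conj (sqfun_ge0 _ _ _)), (rpow_le _ _ p) in H; [|lra].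
      rewrite rpow_mul_base, rpow_rpow in H
        by (try apply rpow_ge0; left; apply Rinv_0_lt_compat; lra).
      replace (q / p * p) with q in H by (field; lra). exact H.
    - rewrite avg_scal. apply Rmult_le_compat_l; [apply rpow_ge0|exact HW]. }
  pose proof (opnorm_Hpow X tau p M I g m C1 ltac:(lra) HM Hval HC1 Hg) as HTg.
  fold J in HTg.
  set (Tg := fun i => bscal X (rpow (dlen (I i) / dlen (tau (I i))) (/ p)) (g i)) in HTg.
  destruct (maximal_rearrangement X tau p M Ec I m (fun i => rpow (1 + s i) q) W)
    as [V [HV0 [HV HVint]]]; auto; try lra.
  { intros i. now apply rpow_gt0. }
  { intros t. apply rpow_ge0. }
  { intros i t Ht. apply rpow_le; [lra|]. split; [left; apply Hs|].
    pose proof (interval_sq_le X I x m i t Ht). unfold s. lra. }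
  set (K := rpow (emb_const p) (2 / (2 - p)) * rpow M (2 * p / (2 - p)) * Ec) in HVint.
  assert (EK : K = C2 * rpow M (2 * p / (2 - p))) by (unfold K, C2; ring).
  assert (HK : 0 < K) by (rewrite EK; apply Rmult_lt_0_compat; [exact HC2|now apply rpow_gt0]).
  fold J in HVint, HV.
  set (Tf := fun i => bscal X (rpow (dlen (I i) / dlen (tau (I i))) (/ q)) (x i)).
  assert (HTf : Hpow q J Tf m <=
      rpow (rpow M p * C1) (q / p) * rpow K (1 - q / p)).
  { apply Rle_trans with (dyadic_mean (resolution J m) (fun t =>
      rpow (rpow (sqfun (indexed_series J Tg m) t) p) (q / p) * rpow (V t) (1 - q / p))).
    - apply avg_le. intros t.
      assert (Hpq : 0 <= / q - / p).
      { apply Rmult_le_reg_r with q; [lra|]. rewrite Rmult_minus_distr_r, Rinv_l by lra.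
        unfold Rdiv in Hqp1. lra. }
      (* [Tf] arises from [Tg] by the multipliers [((1 + s_i)^q r_i)^(1/q-1/p)], which [V] controls
         on [J i]. *)
      assert (H : sqfun (indexed_series J Tf m) t <= rpow (V t) (/ q - / p) * sqfun (indexed_series J Tg m) t).
      { apply sqfun_contraction; [apply rpow_ge0|]. intros i Hi Ht.
        apply haar_neq0_mem, (HV i t Hi) in Ht.
        exists (rpow (rpow (1 + s i) q * r i) (/ q - / p)). split.
        - rewrite Rabs_pos_eq by apply rpow_ge0. apply rpow_le; [exact Hpq|].
          split; [|exact Ht]. apply Rmult_le_pos; [apply rpow_ge0|left; apply Hr].
        - unfold Tf, Tg, g. rewrite !bscal_assoc. f_equal.
          fold (J i). fold (r i).
          rewrite rpow_mul_base, rpow_rpow by (try apply rpow_ge0; left; apply Hr).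
          replace (q * (/ q - / p)) with (- (q / p - 1)) by (field; lra).
          replace (rpow (r i) (/ q)) with (rpow (r i) (/ q - / p) * rpow (r i) (/ p))
            by (rewrite <- rpow_plus; f_equal; ring).
          transitivity ((rpow (1 + s i) (q / p - 1) * rpow (1 + s i) (- (q / p - 1))) *
            (rpow (r i) (/ q - / p) * rpow (r i) (/ p))); [|ring].
          rewrite rpow_opp by apply Hs. ring. }
      apply (conj (sqfun_ge0 _ _ _)), (rpow_le _ _ q (Rlt_le _ _ Hq)) in H.
      apply Rle_trans with (1 := H).
      rewrite rpow_mul_base, !rpow_rpow by (try apply rpow_ge0; apply sqfun_ge0).
      replace ((/ q - / p) * q) with (1 - q / p) by (field; lra).
      replace (p * (q / p)) with q by (field; lra). lra.
    - apply avg_Hoelder; auto.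
      + apply Rmult_lt_0_compat; [now apply rpow_gt0|exact HC1].
      + intros t. apply rpow_ge0. }
  rewrite rpow_rpow. replace (/ q * (q / (2 - q))) with (/ (2 - q)) by (field; lra).
  apply Rle_trans with (rpow (rpow (rpow M p * C1) (q / p) * rpow K (1 - q / p)) (/ (2 - q))).
  - apply rpow_le; [lra|]. split; [apply Hpow_ge0|exact HTf].
  (* The exponent of [M] is [q + 2(p-q)/(2-p) = p(2-q)/(2-p)], divided by [2-q]. *)
  - right. rewrite EK. rewrite !(rpow_mul_base _ _ (_ / _)), !(rpow_mul_base _ _ (1 - _))
      by (try apply rpow_ge0; lra).
    rewrite !rpow_rpow.
    transitivity (rpow (rpow C1 (q / p) * rpow C2 (1 - q / p) *
      (rpow M (p * (q / p)) * rpow M (2 * p / (2 - p) * (1 - q / p)))) (/ (2 - q))).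
    { f_equal. ring. }
    rewrite rpow_mul_base by (apply Rmult_le_pos; apply rpow_ge0).
    f_equal. rewrite <- rpow_plus, rpow_rpow. f_equal. field. lra.
Qed.
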